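(* If $G$ is a $3$-connected planar graph, then $\kappa_\rho(G) \geq \frac{21}{256}$. Moreover, for every $\varepsilon > 0$ there exists a $3$-connected planar graph $H$ such that $\kappa_\rho(H) \leq \frac{1}{3} + \varepsilon$.
   Context: For a tree $T$, $\Lambda(T)$ denotes its set of leaves. For a connected graph $G$, $\tau_G$ is the set of spanning trees of $G$. The robust connectivity of $G$ is $\kappa_\rho(G) = \min_{\emptyset \neq R \subseteq V(G)} \max_{T \in \tau_G} \frac{|R \cap \Lambda(T)|}{|R|}$. All graphs are simple. *)

(* Defs.v *)
From mathcomp Require Import all_boot all_order all_algebra.
From mathcomp Require Import all_classical all_reals all_analysis.
Import Order.TTheory GRing.Theory Num.Theory numFieldNormedType.Exports.

Set Implicit Arguments.
Unset Strict Implicit.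
Unset Printing Implicit Defensive.

Local Open Scope classical_set_scope.
Local Open Scope ring_scope.

(* Finite simple graphs; an edge is the 2-element set of its endpoints. *)
Record graph := Graph {
  vertex :> finType;
  edges : {set {set vertex}};
  card_edge : forall e : {set vertex}, e \in edges -> #|e| = 2%N
}.

Definition adj (V : finType) (E : {set {set V}}) : rel V :=
  [rel x y | [set x; y]%SET \in E].

(* The graph induced by (V, E) on the vertex subset S is connected; the null
   graph is not regarded as connected. *)
Definition connected_on (V : finType) (E : {set {set V}}) (S : {set V}) : Prop :=
  S != finset.set0 /\
  forall x y : V, x \in S -> y \in S ->
    connect [rel u v | [&& adj E u v, u \in S & v \in S]] x y.

Definition k_connected (k : nat) (G : graph) : Prop :=
  (k < #|G|)%N /\
  forall X : {set G}, (#|X| < k)%N -> connected_on (edges G) (finset.setC X).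

(* The size bound is needed: [:: x; y] is a ucycle whenever xy is an edge. *)
Definition acyclic (V : finType) (E : {set {set V}}) : Prop :=
  forall c : seq V, (2 < size c)%N -> ~ ucycle (adj E) c.

(* A spanning tree has vertex set V(G), so it is given by its edge set. *)
Definition spanning_tree (G : graph) (T : {set {set G}}) : Prop :=
  [/\ T \subset edges G, connected_on T finset.setT & acyclic T].

Definition leaves (V : finType) (T : {set {set V}}) : {set V} :=
  [set x | #|[set y | adj T x y]%SET| == 1%N]%SET.

(* All the ratios lie in [0, 1]: for a connected graph the default values 0 and
   1 of the iterated max and min do not affect the result. *)
Definition robust_connectivity (R : realType) (G : graph) : R :=
  \big[Num.min/1]_(S : {set G} | S != finset.set0)
    \big[Num.max/0]_(T : {set {set G}} | `[< spanning_tree T >])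
      (#|S :&: leaves T|%:R / #|S|%:R).

(* [pos] places the vertices and [gamma e], restricted to [0, 1], is a simple
   arc drawing the edge e; edges may meet only at common endpoints. *)
Definition plane_embedding (R : realType) (G : graph)
    (pos : G -> R * R) (gamma : {set G} -> R -> R * R) : Prop :=
  [/\ injective pos,
      forall e, e \in edges G ->
        [/\ {within `[0, 1], continuous (gamma e)},
            {in `[0, 1] &, injective (gamma e)},
            gamma e @` [set 0; 1] = pos @` [set` e] &
            gamma e @` `]0, 1[ `&` range pos = set0] &
      forall e f, e \in edges G -> f \in edges G -> e != f ->
        gamma e @` `]0, 1[ `&` gamma f @` `]0, 1[ = set0].

Definition planar (R : realType) (G : graph) : Prop :=
  exists (pos : G -> R * R) (gamma : {set G} -> R -> R * R),
    plane_embedding pos gamma.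

(* Main.v *)
Require Import Defs.
From mathcomp Require Import all_boot all_order all_algebra.
From mathcomp Require Import all_classical all_reals all_analysis.
From mathcomp Require Import zify lra.
From mathcomp.boot Require Import bigop fintype finset.
Import Order.TTheory GRing.Theory Num.Theory numFieldNormedType.Exports.

(** Planarity enters only through a mod 2 form of van Kampen's obstruction.
Sampling the arcs of a drawing finely and counting crossings of a fixed ray
gives bits satisfying one linear equation for each pair of disjoint edges; such
bits survive contraction and rule out K5 and K3,3, so an extremal argument
yields a vertex of degree at most 5.

Lower bound (with constant 1/12): keep a set [W] of alive vertices and a set
[U] of undecided ones such that no two vertices of [U] separate [W].  As long as
[U] is nonempty, some [r] in [U] can be turned into a leaf at the price of
keeping at most 11 further vertices [Y] of [U] for good, where [Y] meets every
3-cut through [r].  If this failed, uncrossing would show that 3-cuts split off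
either at most 3 or at least 10 vertices of [U]; working inside a minimal large
side, either a maximal small side provides [r], or all relevant 3-cuts split off
kept vertices only, and the graph joining two vertices of [U] in a common such
cut satisfies the mod 2 equations, hence has a vertex [r] of degree at most 5.

Upper bound: subdivide the edges of a long ladder closed up by one extra vertex
and join the subdivision vertices of adjacent edges.  The kept subdivision
vertices must connect the [2m+1] original vertices, so at most [m+2] of the
[3m+2] subdivision vertices are leaves. *)

Set Implicit Arguments.
Unset Strict Implicit.
Unset Printing Implicit Defensive.

Local Open Scope nat_scope.

(** * The mod 2 planarity obstruction *)

(** A set [D] consists of leaves of some spanning tree as soon as [G - D] is connected and each
    vertex of [D] has a neighbour outside [D], so the lower bound asks for a large such subset of a
    given vertex set. Deleting [r] turns a 3-cut through [r] into a 2-cut. Only cuts made of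
    undecided vertices are dangerous, since kept vertices are never deleted; this is why [tough]
    looks at cuts inside [U] only, and why keeping one further vertex of each 3-cut through [r] is
    enough. A step settles at most 12 vertices and yields one leaf, and 1/12 > 21/256. The number 11
    arises three times: as 8 + 3 for a fragment with at most 9 undecided vertices, as the maximum of
    3 + c + (4 - c)(c + 1) over c = 1, 2, 3, and as 3 + 5 + 3 in the last case, where 5 is the
    degree bound from planarity. In the upper bound, 2m + 1 components need at least 2m of the 3m +
    2 subdivision vertices to join them, which leaves m + 2. *)

Inductive xor_term := XVar of nat | XTrue | XFalse | XAdd of xor_term & xor_term.

Fixpoint xor_eval (env : seq bool) t :=
  match t with
  | XVar i => nth false env i
  | XTrue => true
  | XFalse => false
  | XAdd t u => xor_eval env t (+) xor_eval env u
  end.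

Fixpoint xor_parity t : bool * (nat -> bool) :=
  match t with
  | XVar i => (false, fun j => i == j)
  | XTrue => (true, fun _ => false)
  | XFalse => (false, fun _ => false)
  | XAdd t u =>
      let: (b, f) := xor_parity t in let: (c, g) := xor_parity u in
      (b (+) c, fun j => f j (+) g j)
  end.

(** Reflection principle behind [xor_ring]: an exclusive-or expression is determined by its constant
    and the parity of the occurrences of each atom. *)
Lemma xor_parityP (env : seq bool) (t u : xor_term) :
  (let: (b, f) := xor_parity t in let: (c, g) := xor_parity u in
   (b == c) && all (fun j => f j == g j) (iota 0 (size env))) ->
  xor_eval env t = xor_eval env u.
Proof.
have evalE v : xor_eval env v = (xor_parity v).1 (+)
    \big[addb/false]_(j < size env) ((xor_parity v).2 j && nth false env j).
  elim: v => [i|||v1 IH1 v2 IH2] /=.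
  - have [lt_i|le_i] := ltnP i (size env).
      rewrite (bigD1 (Ordinal lt_i)) //= eqxx big1 ?addbF // => j.
      by rewrite -val_eqE eq_sym => /negPf /= ->.
    rewrite nth_default // big1 // => j _; case: eqP => // ij.
    by have := ltn_ord j; rewrite -ij ltnNge le_i.
  - by rewrite big1.
  - by rewrite big1.
  - rewrite IH1 IH2; case: (xor_parity v1) (xor_parity v2) => b f [c g] /=.
    rewrite addbACA -big_split /=; congr (_ (+) _); apply: eq_bigr => j _.
    by rewrite andb_addl.
rewrite !evalE; case: (xor_parity t) (xor_parity u) => b f [c g] /= /andP[/eqP-> /allP fg].
congr (_ (+) _); apply: eq_bigr => j _.
by rewrite (eqP (fg j _)) // mem_iota ltn_ord.
Qed.

Ltac xor_index a env :=
  lazymatch env with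
  | a :: _ => constr:(0%N)
  | _ :: ?env' => let i := xor_index a env' in constr:(i.+1)
  end.
Ltac xor_atoms t env :=
  lazymatch t with
  | true => env
  | false => env
  | ?a (+) ?b => let env' := xor_atoms a env in xor_atoms b env'
  | ~~ ?a => xor_atoms a env
  | ?a => match env with
          | context [cons a _] => env
          | _ => constr:(a :: env)
          end
  end.
Ltac xor_reify t env :=
  lazymatch t with
  | true => constr:(XTrue)
  | false => constr:(XFalse)
  | ?a (+) ?b => let u := xor_reify a env in
                 let v := xor_reify b env in constr:(XAdd u v)
  | ~~ ?a => let u := xor_reify a env in constr:(XAdd XTrue u)
  | ?a => let i := xor_index a env in constr:(XVar i)
  end.
Ltac xor_ring :=
  lazymatch goal with |- ?a = ?b =>
    let env := xor_atoms (a (+) b) (@nil bool) in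
    let u := xor_reify a env in
    let v := xor_reify b env in
    apply: (@xor_parityP env u v); vm_compute; reflexivity
  end.

(* In a drawing, [theta a b v] is the parity of the crossings of the edge [ab]
   with a fixed ray issuing from [v], and [h x y] tells whether [x - y] points
   into a fixed half-plane. *)
Definition van_kampen (V : finType) (e : rel V) : Prop :=
  exists (theta : V -> V -> V -> bool) (h : V -> V -> bool),
    (forall x y, x != y -> h x y = ~~ h y x) /\
    forall a b c d, e a b -> e c d ->
      a != c -> a != d -> b != c -> b != d ->
      theta a b c (+) theta a b d (+) theta c d a (+) theta c d b =
      h a c (+) h a d (+) h b c (+) h b d.

Fixpoint walk_sum (V : Type) (theta : V -> V -> V -> bool) (a : V) (p : seq V)
    (v : V) : bool :=
  if p is x :: q then theta a x v (+) walk_sum theta x q v else false.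

(** Adds the equations [a = b] and [c = d] modulo 2; the last premise is a pure identity left to
    [xor_ring]. *)
Lemma addb_eqD (a b c d x y : bool) :
  a = b -> c = d -> x (+) y = a (+) b (+) c (+) d -> x = y.
Proof. by move=> -> ->; rewrite addbb addFb addbb; case: x; case: y. Qed.

(** Add the equations for all pairs of an edge of one walk and an edge of the other. Terms at inner
    vertices occur twice and cancel, so only those at the four ends remain. Disjointness of the
    walks makes every such pair of edges disjoint. *)
Lemma van_kampen_walks (V : finType) (e e' : rel V) (w : V -> V -> seq V) :
  van_kampen e ->
  (forall a b, e' a b -> path e a (w a b) /\ last a (w a b) = b) ->
  (forall a b c d, e' a b -> e' c d ->
     a != c -> a != d -> b != c -> b != d ->
     [disjoint a :: w a b & c :: w c d]) ->
  van_kampen e'.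
Proof.
move=> [theta [h [hN vk]]] wP dP.
exists (fun a b => walk_sum theta a (w a b)), h; split=> // a b c d eab ecd ac ad bc bd.
have [pab lab] := wP _ _ eab; have [pcd lcd] := wP _ _ ecd.
have := dP _ _ _ _ eab ecd ac ad bc bd.
move: (w a b) (w c d) pab lab pcd lcd => p q pp lp pq lq dpq.
have step u v : e u v -> forall s x, path e x s ->
    [disjoint [:: u; v] & x :: s] ->
    theta u v x (+) theta u v (last x s) (+) walk_sum theta x s u
      (+) walk_sum theta x s v =
    h u x (+) h u (last x s) (+) h v x (+) h v (last x s).
  move=> euv; elim=> [|y s IH] x /=; first by move=> _ _; xor_ring.
  case/andP=> exy ps; rewrite disjoint_sym disjoint_cons => /andP[xuv].
  rewrite disjoint_sym => d1.
  have := IH y ps d1.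
  move: d1; rewrite disjoint_sym disjoint_cons => /andP[yuv _].
  move: xuv yuv; rewrite !inE !negb_or => /andP[xu xv] /andP[yu yv].
  have := vk u v x y euv exy; rewrite ![u == _]eq_sym ![v == _]eq_sym.
  move=> /(_ xu yu xv yv) E1 E2; apply: (addb_eqD E1 E2); xor_ring.
elim: p a pp lp dpq {eab ac ad} => [|x p IH] a /=.
  by move=> _ -> _; xor_ring.
case/andP=> eax pp lp; rewrite disjoint_cons => /andP[anq dpq].
have E1 := IH x pp lp dpq.
have dax : [disjoint [:: a; x] & c :: q].
  rewrite disjoint_cons anq disjoint_cons disjoint0 ?andbT //=.
  by move: dpq; rewrite disjoint_cons => /andP[].
have := step a x eax q c pq dax; rewrite lq => E2.
apply: (addb_eqD E1 E2); xor_ring.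
Qed.

Lemma addb_eq_acc (x a b : bool) : x = false -> a = b -> x (+) (a (+) b) = false.
Proof. by move=> -> ->; rewrite addbb. Qed.

(** In the sum over the 15 pairs of disjoint edges each [theta] term occurs twice, and each pair of
    vertices enters six [h] terms. Writing every [h] with increasing indices costs three negations
    per 4-set of vertices, 15 in all, so the sum reads 0 = 1. *)
Lemma van_kampen_no_K5 (V : finType) (e : rel V) (s : seq V) :
  van_kampen e -> uniq s -> size s = 5 -> {in s &, forall x y, x != y -> e x y} ->
  False.
Proof.
move=> [theta [h [hN vk]]] us ss es.
have x0 : V by case: (s) ss.
pose p := nth x0 s.
have pN i j : (i < 5) -> (j < 5) -> i != j -> p i != p j.
  by move=> i5 j5 ij; rewrite /p nth_uniq ?ss.
have V4 i j k l : [&& i < 5, j < 5, k < 5, l < 5 & uniq [:: i; j; k; l]] ->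
    theta (p i) (p j) (p k) (+) theta (p i) (p j) (p l) (+)
    theta (p k) (p l) (p i) (+) theta (p k) (p l) (p j) =
    h (p i) (p k) (+) h (p i) (p l) (+) h (p j) (p k) (+) h (p j) (p l).
  case/and5P=> i5 j5 k5 l5; rewrite /= !inE !negb_or.
  case/and4P=> /and3P[ij ik il] /andP[jk jl] kl _.
  by apply: vk; rewrite ?pN //; apply: es; rewrite ?mem_nth ?ss // pN.
have H i j : [&& i < 5, j < 5 & i != j] -> h (p i) (p j) = ~~ h (p j) (p i).
  by case/and3P=> i5 j5 ij; apply: hN; rewrite pN.
pose acc := addb_eq_acc.
have := acc _ _ _ (acc _ _ _ (acc _ _ _ (acc _ _ _ (acc _ _ _
       (acc _ _ _ (acc _ _ _ (acc _ _ _ (acc _ _ _ (acc _ _ _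
       (acc _ _ _ (acc _ _ _ (acc _ _ _ (acc _ _ _ (acc _ _ _ (erefl false)
  (V4 0 1 2 3 isT)) (V4 0 1 2 4 isT)) (V4 0 1 3 4 isT))
  (V4 0 2 1 3 isT)) (V4 0 2 1 4 isT)) (V4 0 2 3 4 isT))
  (V4 0 3 1 2 isT)) (V4 0 3 1 4 isT)) (V4 0 3 2 4 isT))
  (V4 0 4 1 2 isT)) (V4 0 4 1 3 isT)) (V4 0 4 2 3 isT))
  (V4 1 2 3 4 isT)) (V4 1 3 2 4 isT)) (V4 1 4 2 3 isT).
rewrite (H 2 1) // (H 3 1) // (H 4 1) // (H 3 2) // (H 4 2) // (H 4 3) //.
by move=> T; have : true = false by rewrite -[RHS]T; xor_ring.
Qed.

(** The count for K5, now over 18 pairs of disjoint edges: all terms cancel and the reversed [h]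
    terms leave an odd number of negations. *)
Lemma van_kampen_no_K33 (V : finType) (e : rel V) (s : seq V) :
  van_kampen e -> uniq s -> size s = 6 ->
  (forall i j, i < 3 -> 3 <= j < 6 -> forall x0, e (nth x0 s i) (nth x0 s j)) ->
  False.
Proof.
move=> [theta [h [hN vk]]] us ss es.
have x0 : V by case: (s) ss.
pose p := nth x0 s.
have pN i j : (i < 6) -> (j < 6) -> i != j -> p i != p j.
  by move=> i5 j5 ij; rewrite /p nth_uniq ?ss.
have V4 i j k l : [&& i < 3, 3 <= j < 6, k < 3, 3 <= l < 6 & uniq [:: i; j; k; l]] ->
    theta (p i) (p j) (p k) (+) theta (p i) (p j) (p l) (+)
    theta (p k) (p l) (p i) (+) theta (p k) (p l) (p j) =
    h (p i) (p k) (+) h (p i) (p l) (+) h (p j) (p k) (+) h (p j) (p l).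
  case/and5P=> i5 j5 k5 l5; rewrite /= !inE !negb_or.
  case/and4P=> /and3P[ij ik il] /andP[jk jl] kl _.
  have [i6 k6] : i < 6 /\ k < 6 by lia.
  have [j6 l6] : j < 6 /\ l < 6 by lia.
  by apply: vk; rewrite ?pN //; apply: es.
have H i j : [&& i < 6, j < 6 & i != j] -> h (p i) (p j) = ~~ h (p j) (p i).
  by case/and3P=> i5 j5 ij; apply: hN; rewrite pN.
pose acc := addb_eq_acc.
have := acc _ _ _ (acc _ _ _ (acc _ _ _ (acc _ _ _ (acc _ _ _ (acc _ _ _
       (acc _ _ _ (acc _ _ _ (acc _ _ _ (acc _ _ _ (acc _ _ _ (acc _ _ _
       (acc _ _ _ (acc _ _ _ (acc _ _ _ (acc _ _ _ (acc _ _ _ (acc _ _ _ (erefl false)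
  (V4 0 3 1 4 isT)) (V4 0 3 1 5 isT)) (V4 0 3 2 4 isT)) (V4 0 3 2 5 isT))
  (V4 0 4 1 3 isT)) (V4 0 4 1 5 isT)) (V4 0 4 2 3 isT)) (V4 0 4 2 5 isT))
  (V4 0 5 1 3 isT)) (V4 0 5 1 4 isT)) (V4 0 5 2 3 isT)) (V4 0 5 2 4 isT))
  (V4 1 3 2 4 isT)) (V4 1 3 2 5 isT)) (V4 1 4 2 3 isT)) (V4 1 4 2 5 isT))
  (V4 1 5 2 3 isT)) (V4 1 5 2 4 isT).
rewrite (H 3 1) // (H 4 1) // (H 5 1) // (H 3 2) // (H 4 2) // (H 5 2) //.
rewrite (H 4 3) // (H 5 3) // (H 5 4) //.
by move=> T; have : true = false by rewrite -[RHS]T; xor_ring.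
Qed.

Lemma van_kampen_sub (V : finType) (e e' : rel V) :
  subrel e' e -> van_kampen e -> van_kampen e'.
Proof.
move=> sub [theta [h [hN vk]]]; exists theta, h; split=> // a b c d /sub + /sub.
exact: vk.
Qed.

(** [v] is merged into [u] but stays in the type as an isolated vertex, so that the vertex type does
    not change. *)
Definition contract (V : eqType) (e : rel V) (u v : V) : rel V :=
  [rel x y | [&& x != y, x != v, y != v &
     [|| e x y, (x == u) && e v y | (y == u) && e x v]]].

Lemma van_kampen_contract (V : finType) (e : rel V) (u v : V) :
  symmetric e -> e u v -> van_kampen e -> van_kampen (contract e u v).
Proof.
move=> sym euv vk.
(* New edges at [u] are routed through [v]. Two edges without a common end cannot both end at [u],
   so at most one of their walks visits [v]. *)
pose w x y := if e x y then [:: y] else if x == u then [:: v; y] else [:: v; u].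
have wP x y : contract e u v x y ->
    [/\ path e x (w x y), last x (w x y) = y, x != v, y != v &
        forall z, z \in x :: w x y -> z = x \/ z = y \/
          (z = v /\ (x = u \/ y = u))].
  case/and4P=> xy xv yv; rewrite /w; case: ifP => [exy _|_ /=].
    split=> //=; first by rewrite exy.
    by move=> z; rewrite !inE => /orP[]/eqP->; auto.
  move: xy xv; have [->|xu] /= := eqVneq x u.
    rewrite euv eq_sym => /negPf-> uv; rewrite orbF => ->; split=> //.
    by move=> z; rewrite !inE => /or3P[]/eqP->; auto 6.
  move=> xy xv /andP[/eqP yu exv]; rewrite exv sym euv; split=> //.
  by move=> z; rewrite !inE yu => /or3P[]/eqP->; auto 6.
apply: (van_kampen_walks vk (w := w)) => [a b /wP[]//|a b c d].
case/wP=> _ _ av bv wab /wP[_ _ cv dv wcd].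
move=> /eqP ac /eqP ad /eqP bc /eqP bd.
move: av bv cv dv => /eqP av /eqP bv /eqP cv /eqP dv.
rewrite disjoint_has; apply/hasPn => z /wab zab; apply/negP => /wcd zcd.
intuition congruence.
Qed.

(** * The edge bound 3n - 6 *)

Definition nbrs (V : finType) (e : rel V) (W : {set V}) (x : V) : {set V} :=
  [set y in W | e x y].

(** For symmetric irreflexive [e], twice the number of edges inside [W]. *)
Definition arcs (V : finType) (e : rel V) (W : {set V}) : nat :=
  \sum_(x in W) #|nbrs e W x|.

(** The contracted edge accounts for 2 arcs, and each common neighbour has two edges merged into
    one, another 2 arcs. *)
Lemma arcs_contract (V : finType) (e : rel V) (W : {set V}) (u v : V) :
  symmetric e -> irreflexive e -> u \in W -> v \in W -> e u v ->
  arcs e W <= arcs (contract e u v) (W :\ v) + 2 + 2 * #|nbrs e W u :&: nbrs e W v|.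
Proof.
move=> sym irr uW vW euv.
have uv : u != v by apply: contraTneq euv => ->; rewrite irr.
set e' := contract e u v; set C := nbrs e W u :&: nbrs e W v.
rewrite /arcs (big_setD1 v) //= (big_setD1 u) /=; last by rewrite !inE uv.
rewrite [X in _ <= X + _ + _](big_setD1 u) /=; last by rewrite !inE uv.
have degu : #|nbrs e W v| + #|nbrs e W u| <= #|nbrs e' (W :\ v) u| + 2 + #|C|.
  rewrite -cardsUI setIC -/C leq_add2r.
  have : nbrs e W v :|: nbrs e W u \subset nbrs e' (W :\ v) u :|: [set u; v].
    apply/subsetP => x; rewrite !inE /=.
    have [->|xu] := eqVneq x u; first by rewrite orbT.
    have [->|xv] := eqVneq x v; first by rewrite !orbT.
    rewrite /e' /contract /= uv xv eqxx [u == x]eq_sym xu /= !orbF.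
    by case/orP => /andP[-> ->]; rewrite ?orbT.
  move/subset_leq_card/leq_trans; apply; apply: (leq_trans (leq_card_setU _ _)).
  by rewrite leq_add2l cards2 uv.
have degx : \sum_(x in W :\ v :\ u) #|nbrs e W x| <=
    \sum_(x in W :\ v :\ u) #|nbrs e' (W :\ v) x| + #|C|.
  have -> : #|C| = \sum_(x in W :\ v :\ u) (x \in C).
    rewrite -sum1_card big_mkcond [in RHS]big_mkcond /=; apply: eq_bigr => x _.
    rewrite !inE; have [->|xu] /= := eqVneq x u; first by rewrite irr andbF.
    have [->|xv] /= := eqVneq x v; first by rewrite irr !andbF.
    by case: (x \in W) => //=; case: (e u x) => //=; case: (e v x).
  rewrite -big_split /=; apply: leq_sum => x; rewrite !inE => /and3P[xu xv xW].
  have e'xu : e' x u = e x u || e x v.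
    by rewrite /e' /contract /= xu xv uv (negPf xu) eqxx.
  rewrite (cardsD1 v) (cardsD1 u (nbrs e' _ _)) (cardsD1 u (_ :\ v)) !inE e'xu.
  rewrite uv uW vW xW /= [e u x]sym [e v x]sym.
  have : nbrs e W x :\ v :\ u \subset nbrs e' (W :\ v) x :\ u.
    apply/subsetP => y; rewrite !inE /e' /contract /= xv; case/and4P=> -> -> ->.
    by rewrite andbT /= => exy; rewrite exy /= andbT; apply: contraTneq exy => ->; rewrite irr.
  move/subset_leq_card; case: (e x v); case: (e x u) => /=; lia.
lia.
Qed.

Definition remove_edge (V : eqType) (e : rel V) (u v : V) : rel V :=
  [rel x y | e x y && ~~ ((x == u) && (y == v) || (x == v) && (y == u))].

Lemma arcs_remove_edge (V : finType) (e : rel V) (W : {set V}) (u v : V) :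
  symmetric e -> u \in W -> v \in W -> e u v ->
  arcs (remove_edge e u v) W < arcs e W <= arcs (remove_edge e u v) W + 2.
Proof.
move=> sym uW vW euv; set e' := remove_edge e u v.
have sub x : nbrs e' W x \subset nbrs e W x.
  by apply/subsetP => y; rewrite !inE => /andP[->] /= /andP[].
apply/andP; split.
  rewrite /arcs (big_setD1 u) //= [X in _ < X](big_setD1 u) //= -addSn leq_add //.
    apply/proper_card/properP; split=> //; exists v; first by rewrite inE vW euv.
    by rewrite inE /e' /remove_edge /= !eqxx /= !andbF.
  by apply: leq_sum => x _; apply: subset_leq_card.
have one z : z \in W -> \sum_(x in W) (x == z : nat) = 1.
  move=> zW; rewrite (big_setD1 z) //= eqxx big1 // => x.
  by rewrite !inE => /andP[/negPf->].
rewrite -[2]/(1 + 1) -{1}(one u uW) -(one v vW) -!big_split /=.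
apply: leq_sum => x _.
have : nbrs e W x \subset nbrs e' W x :|:
    ((if x == u then [set v] else set0) :|: (if x == v then [set u] else set0)).
  apply/subsetP => y; rewrite !inE /e' /remove_edge /= => /andP[-> ->] /=.
  case: (x == u); case: (x == v); rewrite !inE /=;
    by case: (y == u); case: (y == v).
move/subset_leq_card/leq_trans; apply.
apply: leq_trans (leq_card_setU _ _) _; rewrite leq_add2l.
apply: leq_trans (leq_card_setU _ _) _; apply: leq_add.
  by case: (x == u); rewrite ?cards1 ?cards0.
by case: (x == v); rewrite ?cards1 ?cards0.
Qed.

Lemma card3_seq (T : finType) (A : {set T}) : #|A| = 3 ->
  exists a b c, [/\ uniq [:: a; b; c], a \in A, b \in A & c \in A].
Proof.
rewrite cardE; have : uniq (enum A) := enum_uniq _.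
have : {subset enum A <= A} by move=> x; rewrite mem_enum.
case: (enum A) => [|a [|b [|c [|//]]]] // sub u _.
by exists a, b, c; split=> //; apply: sub; rewrite !inE eqxx ?orbT.
Qed.

(* Such a neighbourhood is a complete graph on 4 vertices, or a complete graph
   on 5 vertices minus a matching; with [x] these contain K5 and K3,3. *)
Lemma van_kampen_nbrhood (V : finType) (e : rel V) (W : {set V}) (x : V) :
  van_kampen e -> symmetric e -> irreflexive e -> x \in W ->
  (forall y, y \in nbrs e W x -> 3 <= #|nbrs e W x :&: nbrs e W y|) ->
  nbrs e W x != set0 -> 5 < #|nbrs e W x|.
Proof.
move=> vk sym irr xW; set N := nbrs e W x => deg3 /set0Pn[y0 y0N].
rewrite ltnNge; apply/negP => le5.
have exN y : y \in N -> e x y by rewrite inE => /andP[].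
have xN : x \notin N by rewrite inE irr andbF.
have NN y : y \in N -> N :&: nbrs e W y \subset N :\ y.
  by move=> yN; apply/subsetP => z; rewrite !inE; case: eqP => [->|]; rewrite ?irr ?andbF // => _ /andP[].
have adjN y z : y \in N -> z \in N -> z \in nbrs e W y = e y z.
  by move=> _; rewrite !inE => /andP[-> _].
have : 4 <= #|N|.
  rewrite (cardsD1 y0) y0N add1n ltnS; apply: leq_trans (deg3 _ y0N) _.
  exact/subset_leq_card/NN.
rewrite leq_eqVlt => /orP[/eqP card4|card5].
  apply: (@van_kampen_no_K5 _ _ (x :: enum N) vk).
  - by rewrite /= mem_enum xN enum_uniq.
  - by rewrite /= -cardE -card4.
  have K y z : y \in N -> z \in N -> y != z -> e y z.
    move=> yN zN yz; rewrite -adjN //.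
    have /eqP E : N :&: nbrs e W y == N :\ y.
      rewrite eqEcard NN //=; apply: leq_trans (deg3 _ yN).
      by rewrite (cardsD1 y) yN in card4; lia.
    have : z \in N :\ y by rewrite in_setD1 eq_sym yz zN.
    by rewrite -E in_setI => /andP[].
  move=> y z; rewrite !inE !mem_enum => /orP[/eqP->|yN] /orP[/eqP->|zN] //.
  - by rewrite eqxx.
  - by move=> _; apply: exN.
  - by move=> _; rewrite sym; apply: exN.
  exact: K.
have {le5 card5}card5 : #|N| = 5 by lia.
(* the non-neighbours inside N form a matching *)
have match1 y a b : y \in N -> a \in N -> b \in N -> uniq [:: y; a; b] ->
    ~~ e y a -> e y b.
  move=> yN aN bN uyab nya; apply: contraT => nyb.
  have : N :&: nbrs e W y \subset N :\ y :\ a :\ b.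
    apply/subsetP => z zI; have := subsetP (NN _ yN) _ zI.
    move: zI; rewrite in_setI => /andP[zN]; rewrite adjN // => eyz.
    rewrite !in_setD1 => ->; rewrite andbT.
    by apply/andP; split; apply: contraTneq eyz => ->.
  move/subset_leq_card; have := deg3 _ yN.
  have : #|N| = 3 + #|N :\ y :\ a :\ b|.
    rewrite (cardsD1 y) yN (cardsD1 a) (cardsD1 b (_ :\ a)) !in_setD1 aN bN.
    move: uyab; rewrite /= !inE negb_or => /and3P[/andP[ya yb] ab _].
    by rewrite ![_ == y]eq_sym [b == a]eq_sym ya yb ab.
  rewrite card5; lia.
(* The sides of the K3,3 will be [a, b, G] and [C, D, x]. *)
suff [a [b [G [C [D]]]]] : exists a b G C D,
    [/\ uniq [:: a; b; G; C; D], {subset [:: a; b; G; C; D] <= N} &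
      [/\ e a C, e a D, e b C & e b D] /\ e G C /\ e G D].
  case=> uniqs subN [[aC aD bC bD] [GC GD]].
  have [xa xb xG] : [/\ e a x, e b x & e G x].
    by split; rewrite sym; apply: exN; apply: subN; rewrite !inE eqxx ?orbT.
  apply: (@van_kampen_no_K33 _ _ [:: a; b; G; C; D; x] vk) => //.
    have : x \notin [:: a; b; G; C; D] by apply: contra xN => /subN.
    by rewrite -[[:: a; b; G; C; D; x]]/(rcons [:: a; b; G; C; D] x) rcons_uniq => ->.
  by move=> i j; case: i => [|[|[|]]] // _; case: j => [|[|[|[|[|[|]]]]]].
(* A missing pair serves as [a] and [b], since each then has its only non-neighbour in [N]; if [N]
   is complete, any two vertices do. *)
have [a [b [aN bN ab far]]] : exists a b, [/\ a \in N, b \in N, a != b &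
    (forall z, z \in N -> z != a -> z != b -> e a z /\ e b z)].
  case: (pickP (fun p : V * V => [&& p.1 \in N, p.2 \in N, p.1 != p.2 & ~~ e p.1 p.2])).
    move=> [a b] /= /and4P[aN bN ab nab]; exists a, b; split=> // z zN za zb.
    split; first by apply: (match1 a b) => //; rewrite /= !inE negb_or ab eq_sym za eq_sym zb.
    apply: (match1 b a) => //; last by rewrite sym.
    by rewrite /= !inE negb_or eq_sym ab eq_sym zb eq_sym za.
  move=> full; have [b] : exists b, b \in N :\ y0.
    by apply/card_gt0P; rewrite (cardsD1 y0) y0N in card5; lia.
  rewrite in_setD1 => /andP[by0 bN]; exists y0, b; split=> //; first by rewrite eq_sym.
  move=> z zN z0 zb; have := full (y0, z); have := full (b, z).
  by rewrite /= y0N bN zN ![_ == z]eq_sym z0 zb /= => /negbFE-> /negbFE->.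
have : #|N :\ a :\ b| = 3.
  have bNa : b \in N :\ a by rewrite in_setD1 eq_sym ab bN.
  by move: card5; rewrite (cardsD1 a N) (cardsD1 b (N :\ a)) aN bNa; lia.
case/card3_seq => c [d [g]]; rewrite !in_setD1.
case=> ucdg /and3P[cb ca cN] /and3P[db da dN] /and3P[gb ga gN].
have [Ac Bc] := far _ cN ca cb; have [Ad Bd] := far _ dN da db.
have [Ag Bg] := far _ gN ga gb.
move: ucdg; rewrite /= !inE negb_or => /and3P[/andP[cd cg] dg _].
have base G C D : G \in N -> C \in N -> D \in N -> uniq [:: G; C; D] ->
    G != a -> G != b -> C != a -> C != b -> D != a -> D != b ->
    e G C -> e G D -> [/\ e a C, e a D, e b C & e b D] ->
    exists a b G C D,
    [/\ uniq [:: a; b; G; C; D], {subset [:: a; b; G; C; D] <= N} &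
      [/\ e a C, e a D, e b C & e b D] /\ e G C /\ e G D].
  move=> GN CN DN u Ga Gb Ca Cb Da Db GC GD AB; exists a, b, G, C, D; split=> //.
    move: u; rewrite /= !inE !negb_or ab ![a == _]eq_sym ![b == _]eq_sym.
    by rewrite Ga Gb Ca Cb Da Db /= => ->.
  by move=> z; rewrite !in_cons in_nil orbF => /or4P[|||/orP[]] /eqP->.
(* At most one pair among [c], [d], [g] is non-adjacent, so one of the three is adjacent to the
   other two and can be [G]. *)
have [ecd|ncd] := boolP (e c d).
  have [ecg|ncg] := boolP (e c g).
    by apply: (base c d g) => //; rewrite /= !inE negb_or cd cg dg.
  have egd : e g d.
    apply: (match1 g c d) => //; last by rewrite sym.
    by rewrite /= !inE negb_or ![g == _]eq_sym cg dg cd.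
  apply: (base d c g) => //; rewrite 1?sym //.
  by rewrite /= !inE negb_or eq_sym cd dg cg.
have ecg : e c g.
  by apply: (match1 c d g) => //; rewrite /= !inE negb_or cd cg dg.
have edg : e d g.
  apply: (match1 d c g) => //; last by rewrite sym.
  by rewrite /= !inE negb_or [d == c]eq_sym cd dg cg.
apply: (base g c d) => //; rewrite 1?sym //.
by rewrite /= !inE negb_or ![g == _]eq_sym cd dg cg.
Qed.

(** A minimal counterexample. Contracting an edge with at most two common neighbours loses at most 6
    arcs, exactly what one vertex is worth; so each edge at a vertex of degree at most 5 has three
    common neighbours, which [van_kampen_nbrhood] excludes. *)
Lemma van_kampen_arcs (V : finType) (e : rel V) (W : {set V}) :
  van_kampen e -> symmetric e -> irreflexive e -> 2 < #|W| ->
  arcs e W + 12 <= 6 * #|W|.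
Proof.
have [n] := ubnP #|W|; elim: n e W => // n IHn e W Wn.
have [k] := ubnP (arcs e W); elim: k e => // k IHk e ek.
move=> vk sym irr W3; rewrite leqNgt; apply/negP => big.
have deg1 x : x \in W -> #|nbrs e W x| <= #|W|.-1.
  move=> xW; have -> : #|W|.-1 = #|W :\ x| by rewrite [#|W|](cardsD1 x) xW.
  apply/subset_leq_card/subsetP => y; rewrite !inE => /andP[-> exy].
  by rewrite andbT; apply: contraTneq exy => ->; rewrite irr.
have W4 : 3 < #|W|.
  rewrite ltn_neqAle W3 andbT; apply/eqP => /esym W3'.
  have : arcs e W <= \sum_(x in W) 2.
    by apply: leq_sum => x /deg1; rewrite W3'.
  by rewrite sum_nat_const W3'; lia.
have card1 x : x \in W -> #|W| = (#|W :\ x|).+1.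
  by move=> xW; rewrite (cardsD1 x) xW.
(* If the bound is exceeded by at least 3, it is still violated after removing an edge, which costs
   at most 2 arcs. Otherwise there are fewer than [6 * #|W|] arcs, hence a vertex of degree at most
   5. *)
have [big2|small] := leqP (6 * #|W|) (arcs e W + 9).
  have : 0 < arcs e W by lia.
  rewrite lt0n sum_nat_eq0 negb_forall => /existsP[u].
  rewrite negb_imply cards_eq0 => /andP[uW /set0Pn[v]]; rewrite inE => /andP[vW euv].
  have /andP[lt le] := arcs_remove_edge sym uW vW euv.
  suff : arcs (remove_edge e u v) W + 12 <= 6 * #|W| by lia.
  apply: IHk => //; first by lia.
  - by apply: van_kampen_sub vk => x y /= /andP[].
  - by move=> x y; rewrite /remove_edge /= sym orbC; congr (_ && ~~ (_ || _)); exact: andbC.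
  - by move=> x; rewrite /remove_edge /= irr.
have [x xW degx] : exists2 x, x \in W & #|nbrs e W x| <= 5.
  have [/existsP[x /andP[]]|] := boolP [exists x, (x \in W) && (#|nbrs e W x| <= 5)].
    by exists x.
  rewrite negb_exists => /forallP no.
  suff : \sum_(x in W) 6 <= arcs e W by rewrite sum_nat_const; lia.
  by apply: leq_sum => x xW; have := no x; rewrite xW /= -ltnNge.
have del v : v \in W -> 2 < #|W :\ v| by move/card1; lia.
have common y : y \in nbrs e W x -> 3 <= #|nbrs e W x :&: nbrs e W y|.
  rewrite inE => /andP[yW exy]; rewrite ltnNge; apply/negP => le2.
  have := arcs_contract sym irr xW yW exy.
  have vk' := van_kampen_contract sym exy vk.
  have := card1 _ yW => cW.
  suff : arcs (contract e x y) (W :\ y) + 12 <= 6 * #|W :\ y| by lia.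
  apply: IHn => //; first by lia.
  - move=> a b; rewrite /contract /= sym eq_sym.
    by congr (_ && _); rewrite andbCA; congr [&& _, _ & _ || _]; rewrite orbC ![e y _]sym.
  - by move=> a; rewrite /contract /= eqxx.
  - exact: del.
have := van_kampen_nbrhood vk sym irr xW common.
have [deg0|_ /(_ isT)] := eqVneq (nbrs e W x) set0; last by rewrite ltnNge degx.
have E : arcs e W = arcs e (W :\ x).
  rewrite /arcs (big_setD1 x) //= deg0 cards0 add0n; apply: eq_bigr => y.
  rewrite !inE => /andP[yx yW]; congr #|pred_of_set _|; apply/setP => z; rewrite !inE.
  case: eqP => // ->; have : y \notin nbrs e W x by rewrite deg0 inE.
  by rewrite inE yW /= sym => /negPf->; rewrite andbF.
have cW := card1 _ xW.
suff : arcs e (W :\ x) + 12 <= 6 * #|W :\ x| by lia.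
by apply: IHn => //; [lia | exact: del].
Qed.

Lemma van_kampen_degenerate (V : finType) (e : rel V) (W : {set V}) :
  van_kampen e -> symmetric e -> irreflexive e -> W != set0 ->
  exists2 x, x \in W & #|nbrs e W x| <= 5.
Proof.
move=> vk sym irr /set0Pn[w wW].
have [le2|gt2] := leqP #|W| 2.
  exists w => //; apply: leq_trans (subset_leq_card _) (leq_trans le2 _) => //.
  by apply/subsetP => y; rewrite inE => /andP[].
have := van_kampen_arcs vk sym irr gt2.
have [/existsP[x /andP[xW x5]]|] := boolP [exists x, (x \in W) && (#|nbrs e W x| <= 5)].
  by exists x.
rewrite negb_exists => /forallP no.
suff : \sum_(x in W) 6 <= arcs e W by rewrite sum_nat_const; lia.
by apply: leq_sum => x xW; have := no x; rewrite xW /= -ltnNge.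
Qed.

(** * Three-cuts *)

Ltac nat_lia :=
  repeat match goal with H : ?T |- _ =>
    lazymatch T with
    | is_true (leq _ _) => fail
    | is_true (leq _ _ || leq _ _) => fail
    | @eq nat _ _ => fail
    | _ => clear H
    end
  end; lia.

Lemma card2_other (V : finType) (S : {set V}) r : 1 < #|S| -> exists2 p, p \in S & p != r.
Proof.
move=> S1; have : 0 < #|S :\ r|.
  by move: S1; rewrite (cardsD1 r S); case: (r \in S); nat_lia.
by case/card_gt0P=> p; rewrite in_setD1 => /andP[pr pS]; exists p.
Qed.

Section Separations.

Variables (V : finType) (e : rel V).
Hypotheses (sym : symmetric e) (irr : irreflexive e).

Definition boundary (W A : {set V}) : {set V} :=
  [set y in W :\: A | [exists x in A, e x y]].

Definition exterior (W A : {set V}) : {set V} := W :\: (A :|: boundary W A).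

(* In the graph induced on [W], no set of at most two vertices of [U]
   separates. *)
Definition tough (W U : {set V}) : Prop :=
  U \subset W /\
  forall A : {set V}, A \subset W -> A != set0 -> boundary W A \subset U ->
    exterior W A != set0 -> 3 <= #|boundary W A|.

(** One side of a 3-cut consisting of vertices of [U]; the boundary is the cut. *)
Definition fragment (W U A : {set V}) : bool :=
  [&& A \subset W, A != set0, boundary W A \subset U, exterior W A != set0 &
      #|boundary W A| == 3].

Variables (W U : {set V}).
Hypothesis tou : tough W U.

Local Notation N := (boundary W).
Local Notation ext := (exterior W).
Local Notation frag := (fragment W U).

Lemma boundaryP (A : {set V}) y :
  reflect [/\ y \in W, y \notin A & exists2 x, x \in A & e x y] (y \in N A).
Proof.
rewrite !inE; apply: (iffP idP).
  by case/andP=> /andP[yA yW] /existsP[x /andP[xA exy]]; split=> //; exists x.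
by case=> -> -> [x xA exy]; apply/existsP; exists x; rewrite xA.
Qed.

Lemma boundary_closed (A : {set V}) x y :
  x \in A -> y \in W -> e x y -> (y \in A) || (y \in N A).
Proof.
move=> xA yW exy; case: (boolP (y \in A)) => //= yA.
by apply/boundaryP; split=> //; exists x.
Qed.

Lemma exterior_sub (A : {set V}) : ext A \subset W.
Proof. exact: subsetDl. Qed.

Lemma in_exterior (A : {set V}) y :
  (y \in ext A) = [&& y \in W, y \notin A & y \notin N A].
Proof. by rewrite in_setD in_setU negb_or andbC andbA. Qed.

Lemma trichotomy (A : {set V}) y : y \in W -> [|| y \in A, y \in N A | y \in ext A].
Proof.
by move=> yW; rewrite in_exterior yW; case: (y \in A) => //=; case: (y \in N A).
Qed.

Lemma exterior_anti (A B : {set V}) : A \subset B -> ext B \subset ext A.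
Proof.
move=> /subsetP AB; apply/subsetP => y; rewrite !in_exterior => /and3P[yW yB yNB].
rewrite yW (contra (AB y)) //=; apply: contra yNB => /boundaryP[_ _ [x xA exy]].
by apply/boundaryP; split=> //; exists x => //; apply: AB.
Qed.

Lemma boundary_exterior (A : {set V}) : N (ext A) \subset N A.
Proof.
apply/subsetP => y /boundaryP[yW yE [x]]; rewrite in_exterior => /and3P[xW xA xN] exy.
have [|//|//] := or3P (trichotomy A yW); last by rewrite (negPf yE).
move=> yA; have := boundary_closed yA xW; rewrite sym exy (negPf xA) (negPf xN).
by move/(_ isT).
Qed.

Lemma sub_exterior2 (A : {set V}) : A \subset W -> A \subset ext (ext A).
Proof.
move=> /subsetP AW; apply/subsetP => y yA; rewrite !in_exterior AW ?yA //=.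
by apply/negP => /(subsetP (boundary_exterior A)) /boundaryP[]; rewrite yA.
Qed.

Lemma fragP (A : {set V}) :
  reflect [/\ A \subset W, A != set0, N A \subset U, ext A != set0 & #|N A| = 3] (frag A).
Proof.
by apply: (iffP and5P) => [[? ? ? ? /eqP ?]|[? ? ? ? /eqP ?]].
Qed.

(** A nonempty part of a fragment inherits a nonempty exterior, so toughness bounds its boundary
    below by 3. *)
Lemma frag_intro (A B : {set V}) :
  frag B -> A \subset B -> A != set0 -> N A \subset U -> #|N A| <= 3 -> frag A.
Proof.
case/fragP=> BW _ _ /set0Pn[z zB] _ AB A0 NU le3.
have AW := subset_trans AB BW.
have E : ext A != set0 by apply/set0Pn; exists z; apply: (subsetP (exterior_anti AB)).
by apply/fragP; split=> //; apply/eqP; rewrite eqn_leq le3 tou.2.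
Qed.

(** The uncrossing tool: applied to corners [A :&: B], whose boundaries are controlled by
    [boundaryI]. *)
Lemma frag_card (A B : {set V}) :
  frag B -> A \subset B -> N A \subset U -> #|N A| <= 2 -> A = set0.
Proof.
move=> fB AB NU le2; apply/eqP; apply/negP => /negP A0.
have /fragP[_ _ _ _] := frag_intro fB AB A0 NU (leqW le2).
by move=> E; rewrite E in le2.
Qed.

(** The boundary of the exterior lies in [N A], and toughness rules out a proper subset, so the two
    sides of a 3-cut are interchangeable. *)
Lemma frag_exterior (A : {set V}) :
  frag A -> [/\ frag (ext A), N (ext A) = N A & ext (ext A) = A].
Proof.
case/fragP=> AW A0 NU E0 c3; have sub := boundary_exterior A.
have E1 : ext (ext A) != set0.
  by case/set0Pn: A0 => z zA; apply/set0Pn; exists z; apply: (subsetP (sub_exterior2 AW)).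
have NE : N (ext A) = N A.
  apply/eqP; rewrite eqEcard sub c3; apply: tou.2 => //; first exact: exterior_sub.
  exact: subset_trans sub NU.
split=> //; first by apply/fragP; rewrite NE; split=> //; exact: exterior_sub.
apply/eqP; rewrite eqEsubset sub_exterior2 // andbT; apply/subsetP => y.
rewrite in_exterior NE => /and3P[yW yE yN].
by have := trichotomy A yW; rewrite (negPf yE) (negPf yN) !orbF.
Qed.

Lemma boundaryI (A B : {set V}) y : y \in N (A :&: B) ->
  [|| (y \in N A) && (y \in B), (y \in A) && (y \in N B) | (y \in N A) && (y \in N B)].
Proof.
case/boundaryP=> yW yAB [x]; rewrite in_setI => /andP[xA xB] exy.
have := boundary_closed xA yW exy; have := boundary_closed xB yW exy.
move: yAB; rewrite in_setI.
by case: (y \in A); case: (y \in B); case: (y \in N A); case: (y \in N B).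
Qed.

Lemma boundaryI_sub (A B : {set V}) :
  N A \subset U -> N B \subset U -> N (A :&: B) \subset U.
Proof.
move=> /subsetP NA /subsetP NB; apply/subsetP => y /boundaryI.
by case/or3P=> /andP[]; auto.
Qed.

Lemma boundaryU (A B : {set V}) y : y \in N (A :|: B) -> (y \in N A) || (y \in N B).
Proof.
case/boundaryP=> yW; rewrite in_setU negb_or => /andP[yA yB] [x].
rewrite in_setU => /orP[xA|xB] exy.
  by have := boundary_closed xA yW exy; rewrite (negPf yA) /= => ->.
by have := boundary_closed xB yW exy; rewrite (negPf yB) /= => ->; rewrite orbT.
Qed.

Lemma boundary_submod (A B : {set V}) :
  #|N (A :&: B)| + #|N (A :|: B)| <= #|N A| + #|N B|.
Proof.
rewrite -[X in X <= _]cardsUI -[X in _ <= X]cardsUI; apply: leq_add.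
  apply/subset_leq_card/subsetP => y; rewrite !in_setU => /orP[|/boundaryU//].
  by move/boundaryI/or3P=> [] /andP[yA yB]; rewrite ?yA ?yB ?orbT.
apply/subset_leq_card/subsetP => y; rewrite !in_setI => /andP[/boundaryP[yW _ [x]]].
rewrite in_setI => /andP[xA xB] exy /boundaryP[_ + _].
rewrite in_setU negb_or => /andP[yA yB].
have := boundary_closed xA yW exy; have := boundary_closed xB yW exy.
by rewrite (negPf yA) (negPf yB) /= => -> ->.
Qed.

Lemma boundary_nbr (A : {set V}) r : r \in N A -> exists2 c, c \in A & e r c.
Proof. by case/boundaryP=> _ _ [x xA exr]; exists x; rewrite // sym. Qed.

Lemma boundary_in (A : {set V}) y : y \in N A -> y \notin A.
Proof. by case/boundaryP. Qed.

(** An isolated [r] would be separated from the rest by the empty set. *)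
Lemma tough_nbr r : 1 < #|W| -> r \in U -> exists2 w, w \in W & e r w.
Proof.
move=> W1 rU; have [UW _] := tou; have rW := subsetP UW _ rU.
have [E|/set0Pn[w]] := eqVneq (N [set r]) set0; last first.
  by case/boundaryP=> wW _ [x /set1P->]; exists w.
have := tou.2 [set r]; rewrite sub1set rW E sub0set cards0.
suff -> : ext [set r] != set0 by move=> /(_ isT _ isT isT); rewrite -card_gt0 cards1 => /(_ isT).
have : 0 < #|W :\ r| by move: W1; rewrite (cardsD1 r) rW; nat_lia.
case/card_gt0P=> u; rewrite in_setD1 => /andP[ur uU]; apply/set0Pn; exists u.
by rewrite in_exterior uU // E !inE ur.
Qed.

(** * Structure of 3-cuts when every leaf is blocked *)

Hypothesis U12 : 12 < #|U|.
(* No [r] can be turned into a leaf at the price of at most 11 kept vertices. *)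
Hypothesis blocked : forall r (Y : {set V}), r \in U -> Y \subset U -> r \notin Y ->
  #|Y| <= 11 -> (exists2 w, w \in W & e r w && ((w \notin U) || (w \in Y))) ->
  exists A : {set V}, [/\ frag A, r \in N A & [disjoint N A & Y]].

Lemma has_nbr r : r \in U -> exists2 w, w \in W & e r w.
Proof.
by apply: tough_nbr; apply: leq_trans (subset_leq_card tou.1); apply: leq_trans U12.
Qed.

Definition unique_nbr (B : {set V}) r x : bool :=
  [&& x \in N B, e x r & [forall b in B, e x b ==> (b == r)]].

Lemma unique_nbrP (B : {set V}) r x : unique_nbr B r x ->
  [/\ x \in N B, e x r & forall b, b \in B -> e x b -> b = r].
Proof.
by case/and3P=> xN exr /forall_inP all1; split=> // b bB exb; apply/eqP; have := all1 b bB; rewrite exb.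
Qed.

(** The three vertices of [N B] avoid the cut [N C], so they split between its two sides and one
    side gets at most one. *)
Lemma thin_side (B C : {set V}) : frag B -> frag C -> [disjoint N B & N C] ->
  exists D : {set V}, [/\ frag D, N D = N C, #|N B :&: D| <= 1 & D = C \/ D = ext C].
Proof.
move=> fB fC dBC; have [fE NE EE] := frag_exterior fC.
have /fragP[_ _ _ _ cB] := fB.
have [le1|gt1] := leqP #|N B :&: C| 1; first by exists C; split=> //; left.
exists (ext C); split=> //; last by right.
have : (N B :&: C) :|: (N B :&: ext C) \subset N B by rewrite -setIUr subsetIl.
move/subset_leq_card; rewrite cardsU cB.
suff -> : (N B :&: C) :&: (N B :&: ext C) = set0 by rewrite cards0; nat_lia.
by apply/setP => z; rewrite !in_setI in_exterior in_set0; case: (z \in C); rewrite ?andbF.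
Qed.

(** Keep [N B] and all of [B :&: U] except [r], at most 3 + 8 vertices. The cut through [r] provided
    by [blocked] meets [B] only in [r], so its thin side [D] meets [B] in a set with at most two
    boundary vertices, hence not at all. A neighbour of [r] in [D] therefore lies in [N B] and sees
    only [r] in [B]. *)
Lemma frag_unique_nbr (B : {set V}) r : frag B -> r \in B -> r \in U ->
  #|B :&: U| <= 9 -> exists x, unique_nbr B r x.
Proof.
move=> fB rB rU le9; have /fragP[BW _ NU _ cB] := fB.
pose Y := (B :&: U) :\ r :|: N B.
have YU : Y \subset U.
  by rewrite subUset NU andbT; apply/subsetP => y; rewrite !inE => /and3P[].
have rY : r \notin Y.
  by rewrite in_setU in_setD1 eqxx /=; apply/negP => /boundary_in; rewrite rB.
have cY : #|Y| <= 11.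
  apply: leq_trans (leq_card_setU _ _) _; rewrite cB.
  by move: le9; rewrite (cardsD1 r (B :&: U)) in_setI rB rU; nat_lia.
have [|C [fC rN dY]] := blocked rU YU rY cY.
  have [w wW erw] := has_nbr rU; exists w => //; rewrite erw /=.
  case: (boolP (w \in U)) => //= wU; rewrite in_setU in_setD1 in_setI wU andbT.
  have := boundary_closed rB wW erw; case: eqP => [wr|] //.
  by rewrite wr irr in erw.
have NCB y : y \in N C -> y \in B -> y = r.
  move=> yC yB; apply/eqP; apply: contraT => yr.
  have := disjointFr dY yC; rewrite in_setU in_setD1 in_setI yr yB /=.
  by have /fragP[_ _ /subsetP/(_ _ yC) -> _ _] := fC.
have dBC : [disjoint N B & N C].
  by rewrite disjoint_sym; apply: disjointWr dY; apply: subsetUr.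
have [D [fD ND le1 _]] := thin_side fB fC dBC.
have BD0 : B :&: D = set0.
  apply: (frag_card fB); first exact: subsetIl.
    by apply: boundaryI_sub => //; rewrite ND; have /fragP[] := fC.
  have : N (B :&: D) \subset (N B :&: D) :|: [set r].
    apply/subsetP => y /boundaryI; rewrite ND in_setU in_setI in_set1.
    case/or3P=> /andP[y1 y2]; first by rewrite y1 y2.
      by rewrite (NCB y) // eqxx orbT.
    by rewrite (disjointFr dBC y1) in y2.
  move/subset_leq_card/leq_trans; apply; apply: leq_trans (leq_card_setU _ _) _.
  by rewrite cards1 addn1.
have notBD y : y \in B -> y \in D = false.
  by move=> yB; have := in_set0 y; rewrite -BD0 in_setI yB.
rewrite -ND in rN; have [x xD erx] := boundary_nbr rN; exists x.
have /fragP[/subsetP DW _ _ _ _] := fD.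
have xN : x \in N B.
  by have := boundary_closed rB (DW _ xD) erx; case/orP=> // /notBD; rewrite xD.
apply/and3P; split=> //; first by rewrite sym.
apply/forall_inP => b bB; apply/implyP => exb.
have := boundary_closed xD (subsetP BW _ bB) exb; rewrite notBD //= ND => bN.
by rewrite (NCB b).
Qed.

Lemma unique_nbr_inj (B : {set V}) (S : {set V}) (f : V -> V) :
  (forall r, r \in S -> unique_nbr B r (f r)) -> S \subset B -> {in S &, injective f}.
Proof.
move=> fP SB r s rS sS E; have [_ _ H] := unique_nbrP (fP _ rS).
have [_ ess _] := unique_nbrP (fP _ sS).
by rewrite (H s) // ?E // (subsetP SB).
Qed.

(** Up to 9 undecided vertices, [frag_unique_nbr] embeds [B :&: U] into the 3-element set [N B]. *)
Lemma frag_gap (B : {set V}) : frag B -> (#|B :&: U| <= 3) || (10 <= #|B :&: U|).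
Proof.
move=> fB; have [le9|] := leqP #|B :&: U| 9; last by rewrite orbT.
rewrite orbF; pose f r := odflt r [pick x | unique_nbr B r x].
have fP r : r \in B :&: U -> unique_nbr B r (f r).
  rewrite in_setI => /andP[rB rU]; have [x xP] := frag_unique_nbr fB rB rU le9.
  by rewrite /f; case: pickP => //= /(_ x); rewrite xP.
have /fragP[_ _ _ _ <-] := fB.
rewrite -(card_in_imset (unique_nbr_inj fP (subsetIl _ _))).
by apply/subset_leq_card/subsetP => y /imsetP[r /fP/unique_nbrP[? _ _] ->].
Qed.

Definition small (B : {set V}) : bool := frag B && (#|B :&: U| <= 3).

(** Submodularity gives the union a boundary of size 3. It has at most 6 undecided vertices, so the
    gap leaves at most 3; [U12] keeps its exterior nonempty. *)
Lemma small_union (B C : {set V}) : small B -> small C -> B :&: C != set0 ->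
  small (B :|: C).
Proof.
case/andP=> fB sB /andP[fC sC] BC0.
have /fragP[BW B0 BU Bx cB] := fB; have /fragP[CW C0 CU Cx cC] := fC.
have NU : N (B :|: C) \subset U.
  by apply/subsetP => y /boundaryU /orP[]; [exact: (subsetP BU)|exact: (subsetP CU)].
have cI : 3 <= #|N (B :&: C)|.
  rewrite leqNgt; apply: contra BC0 => lt3; apply/eqP.
  by apply: (frag_card fB) => //; [exact: subsetIl | exact: boundaryI_sub].
have cU : #|N (B :|: C)| <= 3 by have := boundary_submod B C; rewrite cB cC; nat_lia.
have sU : #|(B :|: C) :&: U| <= 6.
  by rewrite setIUl; apply: leq_trans (leq_card_setU _ _) _; nat_lia.
have E0 : ext (B :|: C) != set0.
  have : 0 < #|U :\: (((B :|: C) :&: U) :|: N (B :|: C))|.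
    rewrite cardsD subn_gt0; apply: leq_ltn_trans (subset_leq_card (subsetIr _ _)) _.
    by apply: leq_ltn_trans (leq_card_setU _ _) _; nat_lia.
  case/card_gt0P=> y; rewrite in_setD in_setU in_setI negb_or => /andP[/andP[y1 y2] yU].
  apply/set0Pn; exists y; rewrite in_exterior (subsetP tou.1) // y2 andbT.
  by move: y1; rewrite yU andbT.
have fU : frag (B :|: C).
  apply/fragP; split=> //.
  - by rewrite subUset BW.
  - by case/set0Pn: B0 => b bB; apply/set0Pn; exists b; rewrite in_setU bB.
  - apply/eqP; rewrite eqn_leq cU tou.2 //; first by rewrite subUset BW.
    by case/set0Pn: B0 => b bB; apply/set0Pn; exists b; rewrite in_setU bB.
by rewrite /small fU /=; have := frag_gap fU; nat_lia.
Qed.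

Definition balanced (A : {set V}) : bool :=
  [&& frag A, 10 <= #|A :&: U| & 10 <= #|ext A :&: U|].

Lemma smaller_not_balanced (A B : {set V}) r :
  balanced A -> (forall B : {set V}, balanced B -> #|A :&: U| <= #|B :&: U|) ->
  r \in A -> r \in U -> r \notin B -> B \subset A -> frag B -> #|B :&: U| < 10.
Proof.
case/and3P=> fA _ xA10 minA rA rU rB BA fB; rewrite ltnNge; apply/negP => B10.
have : balanced B.
  rewrite /balanced fB B10 /=; apply: leq_trans xA10 (subset_leq_card _).
  exact/setSI/exterior_anti.
move/minA; rewrite leqNgt => /negP[]; apply/proper_card/properP; split; first exact: setSI.
by exists r; rewrite in_setI ?rA ?rU // (negPf rB).
Qed.

(** Each cut through a vertex of [A] and avoiding [X0] has a small side almost inside [A]. If that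
    side has no undecided vertex in [A], it either witnesses that [r] shares a fully kept side with
    another cut vertex [p], or is a single vertex of [X0]. *)
Definition small_sides (A X0 : {set V}) : Prop :=
  forall r C, r \in A -> frag C -> r \in N C -> [disjoint N C & X0] ->
  exists D : {set V},
    [/\ small D, N D = N C, D \subset A :|: X0 & #|D :&: X0| <= 1] /\
    (D :&: A :&: U = set0 ->
      (exists K p, [/\ frag K, K :&: U = set0, r \in N K, p \in N K &
                       [/\ p \in N C, p \in A & p != r]]) \/
      exists2 x, x \in X0 & D = [set x]).

(** [A] is a balanced fragment with fewest undecided vertices and [X0] its boundary; if nothing is
    balanced, every cut has a small side and [A = W] works with [X0] empty. *)
Lemma small_side_exists : exists A X0 : {set V},
  [/\ X0 \subset U, #|X0| <= 3, A \subset W, A :&: U != set0 & [disjoint A & X0]] /\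
  small_sides A X0.
Proof.
have [A0 bA0|none] := pickP balanced; last first.
  exists W, set0; split.
    split; rewrite ?sub0set ?cards0 -?setI_eq0 ?setI0 //.
    rewrite (setIidPr tou.1) -card_gt0; nat_lia.
  move=> r C rW fC rC _; have /fragP[CW _ _ _ cC] := fC.
  have [fE NE EE] := frag_exterior fC.
  have [D [sD ND]] : exists D : {set V}, small D /\ N D = N C.
    have := frag_gap fC; have := frag_gap fE; have := none C; rewrite /balanced fC /=.
    case: (boolP (#|C :&: U| <= 3)) => [c3 _ _ _|_ + + /= c10].
      by exists C; rewrite /small fC c3.
    by rewrite c10 /= => ->; rewrite orbF => c3; exists (ext C); rewrite /small fE c3.
  have /andP[fD _] := sD; have /fragP[DW _ _ _ _] := fD.
  exists D; split; first by rewrite setU0 setI0 cards0.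
  rewrite (setIidPl DW) => D0; left; have [|p pC pr] := @card2_other _ (N C) r; first by rewrite cC.
  by exists D, p; rewrite ND; split=> //; split=> //; have /boundaryP[] := pC.
have {A0 bA0} [A bA minA] := arg_minnP (fun A : {set V} => #|A :&: U|) bA0.
have := bA; case/and3P=> fA A10 xA10; have /fragP[AW A0 AU Ax cA] := fA.
have [fE NE EE] := frag_exterior fA.
exists A, (N A); split.
  split=> //; rewrite ?cA // -?card_gt0; first nat_lia.
  by rewrite disjoints_subset; apply/subsetP => y yA; rewrite in_setC; apply/negP => /boundary_in; rewrite yA.
move=> r C rA fC rC dCA.
rewrite disjoint_sym in dCA.
have [D [fD ND le1 _]] := thin_side fA fC dCA.
rewrite -ND in rC dCA *; have /fragP[DW D0 DU Dx cD] := fD.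
have rU : r \in U := subsetP DU _ rC.
have rD := boundary_in rC.
have dAD y : y \in N A -> y \in N D -> False by move=> yA; rewrite (disjointFr dCA).
have minD (B : {set V}) : r \notin B -> B \subset A -> frag B -> #|B :&: U| < 10.
  exact: smaller_not_balanced bA minA rA rU.
have small_if (B : {set V}) : frag B -> #|B :&: U| < 10 -> small B.
  by move=> fB lt; rewrite /small fB; have := frag_gap fB; nat_lia.
have NI_U (B : {set V}) : N B \subset U -> N (B :&: D) \subset U by move=> BU; exact: boundaryI_sub.
have aE : #|N D :&: A| + #|N D :&: ext A| <= 3.
  rewrite -cD -cardsUI.
  have -> : (N D :&: A) :&: (N D :&: ext A) = set0.
    by apply/setP => y; rewrite !in_setI in_exterior in_set0; case: (y \in A); rewrite ?andbF.
  by rewrite cards0 addn0 -setIUr; apply/subset_leq_card/subsetIl.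
(* If [D] misses [N A], the corner [A :&: D] is nonempty with boundary inside [N D :&: A]; so [N D]
   lies in [A], and then [D] does. *)
have [b0|] := leqP #|N A :&: D| 0.
  have NAD y : y \in N A -> y \in D = false.
    move=> yN; apply/negP => yD; move: b0; rewrite leqn0 cards_eq0 => /eqP/setP/(_ y).
    by rewrite in_setI yN yD in_set0.
  have IAD : N (A :&: D) \subset N D :&: A.
    apply/subsetP => y /boundaryI; rewrite in_setI.
    by case/or3P=> /andP[y1 y2]; [rewrite NAD in y2|rewrite y1 y2|case: (dAD y)].
  have [d dD erd] := boundary_nbr rC.
  have dA : d \in A.
    by have := boundary_closed rA (subsetP DW _ dD) erd; case/orP => // /NAD; rewrite dD.
  have a3 : 3 <= #|N D :&: A|.
    apply: leq_trans (subset_leq_card IAD); rewrite leqNgt; apply/negP => lt3.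
    have := frag_card fA (subsetIl A D) (NI_U _ AU) lt3; move/setP/(_ d).
    by rewrite in_setI dA dD in_set0.
  have NDA : N D \subset A.
    have /eqP E : N D :&: A == N D by rewrite eqEcard subsetIl cD.
    by rewrite -E subsetIr.
  have xAD : ext A :&: D = set0.
    apply: (frag_card fE); rewrite ?subsetIl ?NI_U ?NE //.
    apply: (@leq_trans 0) => //; rewrite leqn0 cards_eq0; apply/eqP/setP => y.
    rewrite in_set0; apply/negP => /boundaryI; rewrite NE.
    case/or3P=> /andP[y1 y2]; [by rewrite NAD in y2| |by case: (dAD y)].
    by move: y1; rewrite in_exterior (subsetP NDA) // andbF.
  have DA : D \subset A.
    apply/subsetP => y yD; have := trichotomy A (subsetP DW _ yD).
    case/or3P=> // [/NAD|yE]; first by rewrite yD.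
    by have := in_set0 y; rewrite -xAD in_setI yE yD.
  exists D; split.
    split=> //; first exact: small_if _ fD (minD _ rD DA fD).
      by rewrite subsetU // DA.
    by rewrite setIC; nat_lia.
  rewrite (setIidPl DA) => DU0; left.
  have [|p pC pr] := @card2_other _ (N D) r; first by rewrite cD.
  by exists D, p; split=> //; split=> //; apply: (subsetP NDA).
move=> b1; have {b1 le1} : #|N A :&: D| == 1 by rewrite eqn_leq le1.
case/cards1P=> x Nx.
have [xA xD] : x \in N A /\ x \in D.
  by have := set11 x; rewrite -Nx in_setI => /andP[].
have NAD y : y \in N A -> y \in D -> y = x.
  by move=> y1 y2; apply/set1P; rewrite -Nx in_setI y1 y2.
have IAD : N (A :&: D) \subset x |: (N D :&: A).
  apply/subsetP => y /boundaryI; rewrite in_setU1 in_setI.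
  case/or3P=> /andP[y1 y2]; [by rewrite (NAD y) ?eqxx|by rewrite y1 y2 orbT|by case: (dAD y)].
(* Here [D] contains exactly one vertex [x] of [N A]. If [r] is the only cut vertex in [A], then [x]
   sees only [r] in [A], and replacing [x] by [r] in the boundary makes [A :\ r] a fragment; the gap
   and the minimality of [A] exclude this. *)
have [a1|a2] := leqP #|N D :&: A| 1.
  have NDr y : y \in N D -> y \in A -> y = r.
    move=> y1 y2; apply/eqP; apply: contraLR a1 => yr; rewrite -ltnNge.
    rewrite (cardsD1 y) (cardsD1 r (_ :\ y)) !in_setD1 !in_setI y1 y2 rC rA.
    by rewrite eq_sym yr.
  have AD0 : A :&: D = set0.
    apply: (frag_card fA); rewrite ?subsetIl ?NI_U //.
    by apply: leq_trans (subset_leq_card IAD) _; rewrite cardsU1; case: (x \notin _); nat_lia.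
  have xr b : b \in A -> e x b -> b = r.
    move=> b_A exb; have := boundary_closed xD (subsetP AW _ b_A) exb.
    case/orP=> [bD|bN]; last exact: NDr.
    by have := in_set0 b; rewrite -AD0 in_setI b_A bD.
  have cA1 : #|A :&: U| = (#|(A :\ r) :&: U|).+1.
    rewrite (cardsD1 r) in_setI rA rU add1n; congr _.+1; apply: eq_card => y.
    by rewrite !inE andbA.
  have NA1 : N (A :\ r) \subset r |: (N A :\ x).
    apply/subsetP => y /boundaryP[yW]; rewrite in_setD1 negb_and negbK => yA1 [z].
    rewrite in_setD1 => /andP[zr zA] ezy; rewrite in_setU1 in_setD1.
    case/orP: yA1 => [->//|yA]; apply/orP; right; apply/andP; split.
      by apply: contra zr => /eqP yx; rewrite (xr z) // -yx sym.
    by have := boundary_closed zA yW ezy; rewrite (negPf yA).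
  have fA1 : frag (A :\ r).
    apply: (frag_intro fA); rewrite ?subsetDl //.
    - have : 0 < #|(A :\ r) :&: U| by nat_lia.
      by case/card_gt0P=> z; rewrite in_setI => /andP[zA _]; apply/set0Pn; exists z.
    - apply: subset_trans NA1 _; rewrite subUset sub1set rU.
      exact: subset_trans (subsetDl _ _) AU.
    - apply: leq_trans (subset_leq_card NA1) _; rewrite cardsU1.
      by move: cA; rewrite (cardsD1 x) xA; case: (r \notin _); nat_lia.
  have := minD (A :\ r); rewrite in_setD1 eqxx subsetDl => /(_ isT isT fA1).
  by have := frag_gap fA1; nat_lia.
(* Two cut vertices in [A] leave at most one in [ext A]; together with [x] this is too little to
   bound the outer corner. *)
have xAD : ext A :&: D = set0.
  apply: (frag_card fE); rewrite ?subsetIl ?NI_U ?NE //.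
  have : N (ext A :&: D) \subset x |: (N D :&: ext A).
    apply/subsetP => y /boundaryI; rewrite NE in_setU1 in_setI.
    case/or3P=> /andP[y1 y2]; [by rewrite (NAD y) ?eqxx|by rewrite y1 y2 orbT|by case: (dAD y)].
  move/subset_leq_card/leq_trans; apply; rewrite cardsU1; case: (x \notin _); nat_lia.
have cND : #|N D :&: A| = 2.
  have : x \in N (ext A) by rewrite NE.
  case/boundary_nbr => w wE exw.
  have := boundary_closed xD (subsetP (exterior_sub A) _ wE) exw.
  case/orP=> [wD|wN]; first by have := in_set0 w; rewrite -xAD in_setI wE wD.
  have : 0 < #|N D :&: ext A| by apply/card_gt0P; exists w; rewrite in_setI wN.
  nat_lia.
have DA : D \subset x |: (A :&: D).
  apply/subsetP => y yD; rewrite in_setU1 in_setI yD andbT.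
  have := trichotomy A (subsetP DW _ yD); case/or3P=> [->|yN|yE]; first by rewrite orbT.
    by rewrite (NAD y) ?eqxx.
  by have := in_set0 y; rewrite -xAD in_setI yE yD.
have cIAD : #|x |: (N D :&: A)| <= 3 by rewrite cardsU1 cND; case: (x \notin _).
have fAD : A :&: D != set0 -> frag (A :&: D).
  move=> AD0; apply: (frag_intro fA); rewrite ?subsetIl ?NI_U //.
  exact: leq_trans (subset_leq_card IAD) cIAD.
have rAD : r \notin A :&: D by rewrite in_setI (negPf rD) andbF.
exists D; split.
  split=> //.
  - rewrite /small fD; have := frag_gap fD; case/orP=> // D10.
    have AD9 : 9 <= #|(A :&: D) :&: U|.
      have : D :&: U \subset x |: ((A :&: D) :&: U).
        apply/subsetP => y; rewrite in_setI in_setU1 in_setI => /andP[yD ->].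
        by have := subsetP DA _ yD; rewrite in_setU1 andbT.
      by move/subset_leq_card; rewrite cardsU1; case: (x \notin _); nat_lia.
    have AD0 : A :&: D != set0.
      have : 0 < #|(A :&: D) :&: U| by nat_lia.
      by case/card_gt0P=> z; rewrite in_setI => /andP[zA _]; apply/set0Pn; exists z.
    have := minD _ rAD (subsetIl A D) (fAD AD0); have := frag_gap (fAD AD0); nat_lia.
  - apply/subsetP => y /(subsetP DA); rewrite !in_setU1 in_setI in_setU.
    by case/orP=> [/eqP->|/andP[->]//]; rewrite xA orbT.
  - by rewrite setIC Nx cards1.
move=> DAU0; have [AD0|AD0] := eqVneq (A :&: D) set0.
  right; exists x => //; apply/eqP; rewrite eqEsubset sub1set xD andbT.
  by apply: subset_trans DA _; rewrite AD0 setU0.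
left; have [|p] := @card2_other _ (N D :&: A) r; first by rewrite cND.
rewrite in_setI => /andP[pN pA] pr.
have /eqP NK : N (A :&: D) == x |: (N D :&: A).
  by rewrite eqEcard IAD; have /fragP[_ _ _ _ ->] := fAD AD0.
exists (A :&: D), p; split; rewrite ?fAD //; first by rewrite [A :&: D]setIC.
  by rewrite NK in_setU1 in_setI rC rA orbT.
by rewrite NK in_setU1 in_setI pN pA orbT.
Qed.

Lemma leq_card_bigcup (I : finType) (P : {set I}) (F : I -> {set V}) k :
  (forall i, i \in P -> #|F i| <= k) -> #|\bigcup_(i in P) F i| <= #|P| * k.
Proof.
move=> Fk; rewrite -sum_nat_const.
elim/big_rec2: _ => [|i n S iP IH]; first by rewrite cards0.
by apply: leq_trans (leq_card_setU _ _) (leq_add (Fk i iP) IH).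
Qed.

(** Take a maximal small [B] meeting [A :&: U], in [r] say. Keep [X0], the rest of [B :&: U], a
    vertex [y] of [N B], and for each neighbour [n] of [r] in [N B] a set hitting the relevant cuts
    through [r] whose small side contains [n]. A cut left over by [blocked] has a small side that
    either misses [B], contrary to the choice for some [n], or lies inside [B], contrary to the
    choice of [y]. *)
Lemma no_small_meeting (A X0 : {set V}) :
  X0 \subset U -> #|X0| <= 3 -> [disjoint A & X0] -> small_sides A X0 ->
  forall B, small B -> B :&: A :&: U = set0.
Proof.
move=> X0U cX0 dAX sides B0 sB0; apply/eqP; apply: contraT => mB0; exfalso.
pose P B := small B && (B :&: A :&: U != set0).
(* Lexicographic: first the number of undecided vertices, then the size. *)
pose size2 (B : {set V}) := #|B :&: U| * #|V|.+1 + #|B|.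
have PB0 : P B0 by rewrite /P sB0.
have [B /andP[sB mB] maxB] := arg_maxnP size2 PB0.
move: sB0 mB0 PB0 => _ _ _; have /andP[fB B3] := sB; have /fragP[BW _ BU _ cB] := fB.
set c := #|B :&: U| in B3.
have max1 C : P C -> #|C :&: U| <= c.
  move/maxB; rewrite /size2 -/c => le; rewrite -ltnS -(ltn_pmul2r (ltn0Sn #|V|)).
  apply: leq_ltn_trans (leq_trans (leq_addr _ _) le) _.
  by rewrite mulSn addnC ltn_add2r ltnS max_card.
have max2 C : P C -> B \subset C -> C \subset B.
  move=> PC BC; have /eqP -> : B == C; last by [].
  rewrite eqEcard BC /=; have : size2 C <= size2 B := maxB _ PC.
  rewrite /size2.
  have -> : #|C :&: U| = #|B :&: U|.
    by apply/eqP; rewrite eqn_leq max1 //= subset_leq_card // setSI.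
  by rewrite leq_add2l.
have /set0Pn[r] := mB; rewrite !in_setI => /andP[/andP[rB rA] rU].
pose f s := odflt s [pick x | unique_nbr B s x].
have fP s : s \in B :&: U -> unique_nbr B s (f s).
  rewrite in_setI => /andP[sB' sU].
  have [|x xP] := frag_unique_nbr fB sB' sU; first by rewrite -/c; nat_lia.
  by rewrite /f; case: pickP => //= /(_ x); rewrite xP.
have rBU : r \in B :&: U by rewrite in_setI rB.
have c1 : c = #|(B :&: U) :\ r|.+1 by rewrite /c (cardsD1 r) rBU.
pose Ct := [set n in N B | e r n].
(* The other [c - 1] vertices of [B :&: U] have distinct unique neighbours in [N B], none of them
   adjacent to [r]. *)
have cCt : #|Ct| + c <= 4.
  have : Ct :|: f @: ((B :&: U) :\ r) \subset N B.
    apply/subsetP => n; rewrite in_setU => /orP[|/imsetP[s]]; first by rewrite inE => /andP[].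
    by rewrite in_setD1 => /andP[_ /fP/unique_nbrP[sN _ _]] ->.
  move/subset_leq_card; rewrite cardsU cB.
  have -> : Ct :&: f @: ((B :&: U) :\ r) = set0.
    apply/setP => n; rewrite in_setI in_set0 inE; apply/negP.
    case/andP=> /andP[nN ern] /imsetP[s]; rewrite in_setD1 => /andP[sr sBU] ns.
    have [_ _ H] := unique_nbrP (fP _ sBU).
    by move: sr; rewrite -(H r) ?eqxx // -ns sym.
  rewrite cards0 subn0 card_in_imset -?c1; last first.
    apply: (unique_nbr_inj (B := B)) => [s|]; first by rewrite in_setD1 => /andP[_ /fP].
    exact: subset_trans (subsetDl _ _) (subsetIl _ _).
  by move: c1; nat_lia.
have [xN erx xuniq] := unique_nbrP (fP _ rBU).
have [|y yN yx] := @card2_other _ (N B) (f r); first by rewrite cB.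
pose F n C := [&& small C, n \in C, r \in N C & (C :&: A :&: U != set0) || (C :&: U \subset [set n])].
have F_card n C : F n C -> #|C :&: U| <= c.
  case/and4P=> sC _ _ /orP[mC|/subset_leq_card]; first by rewrite max1 // /P sC.
  by rewrite cards1; move: c1; nat_lia.
pose Q n (Z : {set V}) := [&& n \in Z, Z \subset U, r \notin Z, #|Z| <= c.+1 &
  [forall D, F n D ==> ~~ [disjoint N D & Z]]].
(* By [small_union] a largest member [C] of the family contains every other one. A member whose
   boundary avoids [C :&: U] has boundary [N C], so [C :&: U] and one vertex [p] of [N C] hit all of
   them. *)
have QP n : n \in Ct -> exists Z, Q n Z.
  rewrite inE => /andP[nN ern]; have nU : n \in U := subsetP BU _ nN.
  have nr : n != r by apply: contraTneq ern => ->; rewrite irr.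
  case: (pickP (F n)) => [C0 FC0|noF]; last first.
    exists [set n]; rewrite /Q set11 sub1set nU in_set1 eq_sym nr cards1 /=.
    by apply/forallP => D; rewrite noF.
  have [C FC maxC] := arg_maxnP (fun C : {set V} => #|C|) FC0.
  have /and4P[sC nC rC _] := FC; have /andP[fC _] := sC.
  have /fragP[CW _ CU _ cC] := fC.
  have [|p pC pr] := @card2_other _ (N C) r; first by rewrite cC.
  exists (p |: (C :&: U)); apply/and5P; split.
  - by rewrite in_setU1 in_setI nC nU orbT.
  - by rewrite subUset sub1set (subsetP CU) // subsetIr.
  - by rewrite in_setU1 in_setI negb_or eq_sym pr (negPf (boundary_in rC)).
  - by rewrite cardsU1; have := F_card _ _ FC; case: (p \notin _); nat_lia.
  apply/forallP => D; apply/implyP => FD; apply/negP => dD.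
  have /and4P[sD nD rD mD] := FD; have /andP[fD _] := sD.
  have /fragP[DW _ DU _ cD] := fD.
  have CD0 : C :&: D != set0 by apply/set0Pn; exists n; rewrite in_setI nC.
  have FCD : F n (C :|: D).
    rewrite /F small_union // in_setU nC /=; apply/andP; split.
      apply/boundaryP; split; first exact: (subsetP tou.1).
        by rewrite in_setU negb_or !boundary_in.
      by exists n; rewrite ?in_setU ?nC // sym.
    have /and4P[_ _ _ mC] := FC.
    rewrite !setIUl; case/orP: mC => [/set0Pn[z zC]|mC].
      by apply/orP; left; apply/set0Pn; exists z; rewrite in_setU zC.
    case/orP: mD => [/set0Pn[z zD]|mD].
      by apply/orP; left; apply/set0Pn; exists z; rewrite in_setU zD orbT.
    by rewrite subUset mC mD orbT.
  have DC : D \subset C.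
    have /eqP E : C == C :|: D by rewrite eqEcard subsetUl; apply: maxC.
    by rewrite E subsetUr.
  have NDC : N D \subset N C.
    apply/subsetP => z zD; have /boundaryP[zW _ [w wD ewz]] := zD.
    case/orP: (boundary_closed (subsetP DC _ wD) zW ewz) => // zC.
    have := disjointFr dD zD; rewrite in_setU1 in_setI zC (subsetP DU) //.
    by rewrite orbT.
  have /eqP E : N D == N C by rewrite eqEcard NDC cC cD.
  by have := disjointFr dD (etrans (congr1 (fun S : {set V} => p \in S) E) pC); rewrite in_setU1 eqxx.
pose g n := odflt set0 [pick Z | Q n Z].
have gP n : n \in Ct -> Q n (g n).
  by case/QP=> Z QZ; rewrite /g; case: pickP => //= /(_ Z); rewrite QZ.
pose Y := X0 :|: ((B :&: U) :\ r) :|: [set y] :|: \bigcup_(n in Ct) g n.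
have YU : Y \subset U.
  rewrite !subUset X0U sub1set (subsetP BU) // andbT /=; apply/andP; split.
    exact: subset_trans (subsetDl _ _) (subsetIr _ _).
  by apply/bigcupsP => n /gP/and5P[].
have rX0 : r \in X0 = false by rewrite (disjointFr dAX rA).
have rY : r \notin Y.
  rewrite !in_setU in_setD1 in_set1 eqxx rX0 /= negb_or; apply/andP; split.
    by apply/eqP => E; have := boundary_in yN; rewrite -E rB.
  by apply/bigcupP => -[n /gP/and5P[_ _ /negP]].
(* The bound 3 + (c - 1) + 1 + (4 - c)(c + 1) equals 10, 11, 10 for c = 1, 2, 3. *)
have cY : #|Y| <= 11.
  have cg : #|\bigcup_(n in Ct) g n| <= #|Ct| * c.+1.
    by apply: leq_card_bigcup => n /gP/and5P[].
  apply: leq_trans (leq_card_setU _ _) _; apply: leq_trans (leq_add (leq_card_setU _ _) cg) _.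
  rewrite cards1; have := (leq_card_setU X0 ((B :&: U) :\ r)).1.
  move: c1 cX0 cCt B3; case: (c) => [|[|[|[|]]]] //; nat_lia.
have [|C0 [fC0 rC0 dC0]] := blocked rU YU rY cY.
  have [w wW erw] := has_nbr rU; exists w => //; rewrite erw /=.
  case: (boolP (w \in U)) => //= wU; rewrite !in_setU in_setD1 in_setI wU andbT.
  have wr : w != r by apply: contraTneq erw => ->; rewrite irr.
  rewrite wr /=; case/orP: (boundary_closed rB wW erw) => [->|wN]; first by rewrite orbT.
  apply/orP; right; apply/bigcupP; exists w; first by rewrite inE wN.
  by have /gP/and5P[] : w \in Ct by rewrite inE wN.
have dNY z : z \in N C0 -> z \in Y = false by move=> zC; rewrite (disjointFr dC0 zC).
have dX0 : [disjoint N C0 & X0].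
  by apply: disjointWr dC0; rewrite /Y -!setUA subsetUl.
have [D [[sD ND DAX D1] _]] := sides r C0 rA fC0 rC0 dX0.
rewrite -ND in rC0 dNY; have /andP[fD _] := sD; have /fragP[DW _ DU _ cD] := fD.
have [DB0|DB0] := eqVneq (D :&: B) set0.
  have [n nD ern] := boundary_nbr rC0.
  have nB : n \notin B.
    by apply/negP => nB; have := in_set0 n; rewrite -DB0 in_setI nD nB.
  have nN : n \in N B.
    by have := boundary_closed rB (subsetP DW _ nD) ern; rewrite (negPf nB).
  have nCt : n \in Ct by rewrite inE nN.
  have FD : F n D.
    rewrite /F sD nD rC0 /=; case: eqP => //= DAU0; apply/subsetP => z.
    rewrite in_setI => /andP[zD zU]; rewrite in_set1; apply/eqP.
    have inX0 u : u \in D -> u \in U -> u \in X0.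
      move=> uD uU; have := subsetP DAX _ uD; rewrite in_setU => /orP[uA|//].
      by have := in_set0 u; rewrite -DAU0 !in_setI uD uA uU.
    move: D1; rewrite leqNgt; apply: contraNeq => zn.
    rewrite (cardsD1 z) (cardsD1 n (_ :\ z)) !in_setD1 !in_setI zD nD !inX0 //; last exact: (subsetP BU).
    by rewrite eq_sym zn.
  have /and5P[_ _ _ _ /forallP/(_ D)] := gP _ nCt.
  rewrite FD /= => /negP[]; apply/pred0P => z /=; apply/negP => /andP[zD zg].
  have := dNY _ zD; rewrite in_setU => /norP[_ /negP[]].
  by apply/bigcupP; exists n.
have sDB : small (D :|: B) by apply: small_union.
have DB : D \subset B.
  apply: subset_trans (max2 (D :|: B) _ (subsetUr _ _)); first exact: subsetUl.
  rewrite /P sDB; apply/set0Pn; exists r; by rewrite !in_setI in_setU rB orbT rA rU.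
(* The only neighbour of [f r] in [B] is [r], which is not in [D]. Hence [N D] is [N B] with [f r]
   replaced by [r], and contains [y]. *)
have NDr : N D :\ r \subset N B :\ f r.
  apply/subsetP => z; rewrite in_setD1 => /andP[zr zD].
  have /boundaryP[zW _ [w wD ewz]] := zD.
  have zB : z \notin B.
    apply/negP => zB; have := dNY _ zD; rewrite !in_setU in_setD1 in_setI zr zB.
    by rewrite (subsetP DU) // !orbT.
  have := boundary_closed (subsetP DB _ wD) zW ewz; rewrite (negPf zB) /= => zN.
  rewrite in_setD1 zN andbT; apply/eqP => zf.
  have wr : w = r by apply: xuniq; [exact: (subsetP DB) | rewrite -zf sym].
  by have := boundary_in rC0; rewrite -wr wD.
have /eqP E : N D :\ r == N B :\ f r.
  rewrite eqEcard NDr; move: cB cD; rewrite (cardsD1 (f r)) xN (cardsD1 r (N D)) rC0; nat_lia.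
have : y \in N D :\ r by rewrite E in_setD1 yx yN.
by rewrite in_setD1 => /andP[_ /dNY]; rewrite !in_setU set11 !orbT.
Qed.

(** * Links through sides without undecided vertices *)

Definition linked : rel V :=
  [rel r p | (r != p) && [exists K : {set V},
     [&& frag K, K :&: U == set0, r \in N K & p \in N K]]].

Lemma walk_through (K : {set V}) a b : frag K -> K :&: U = set0 ->
  a \in N K -> b \in N K ->
  exists p, [/\ path e a p, last a p = b & {subset p <= b |: K}].
Proof.
move=> fK KU aN bN; have /fragP[KW _ NU _ cK] := fK.
pose eK : rel V := [rel u v | e u v && (v \in K)].
pose A := [set z in K | connect eK a z].
have AK : A \subset K by apply/subsetP => z; rewrite inE => /andP[].
have NAK : N A \subset N K.
  apply/subsetP => y /boundaryP[yW yA [z zA ezy]].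
  case/orP: (boundary_closed (subsetP AK _ zA) yW ezy) => // yK.
  case/negP: yA; move: zA; rewrite !inE yK => /andP[zK az] /=.
  by apply: connect_trans az (connect1 _); rewrite /eK /= ezy.
have A0 : A != set0.
  have [c cK' eac] := boundary_nbr aN; apply/set0Pn; exists c; rewrite inE cK'.
  by apply: connect1; rewrite /eK /= eac.
have fA : frag A.
  by apply: (frag_intro fK AK A0); [exact: subset_trans NU | rewrite -cK subset_leq_card].
have /eqP NE : N A == N K by rewrite eqEcard NAK cK; have /fragP[_ _ _ _ ->] := fA.
rewrite -NE in bN; case/boundaryP: bN => _ _ [z]; rewrite inE => /andP[zK /connectP[p pp ->]] ezb.
exists (rcons p b); rewrite rcons_path last_rcons ezb andbT; split=> //.
  by apply: sub_path pp => u v /andP[].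
move=> y; rewrite mem_rcons inE in_setU1 => /orP[->//|yp]; apply/orP; right.
elim: p a pp yp {aN ezb zK A AK NAK A0 fA NE} => [//|c p IH] a /= /andP[/andP[_ cK'] pp].
by rewrite inE => /orP[/eqP->|]; [|exact: IH pp].
Qed.

(** Realise each link by a walk through its [K]. For links without a common end, the boundary of
    [K :&: L] lies in both cuts, because [K] and [L] contain no undecided vertex. Equal cuts would
    have four vertices, so this boundary has at most two and [K], [L] are disjoint. *)
Lemma van_kampen_linked : van_kampen e -> van_kampen linked.
Proof.
move=> vk.
pose P a b (K : {set V}) := [&& frag K, K :&: U == set0, a \in N K & b \in N K].
pose Pw a b (w : seq V) := exists K, [/\ P a b K, path e a w, last a w = b & {subset w <= b |: K}].
have [w wP] : exists w : V -> V -> seq V, forall a b, linked a b -> Pw a b (w a b).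
  apply: (fin_all_exists (P := fun a f => forall b, linked a b -> Pw a b (f b))) => a.
  apply: (fin_all_exists (P := fun b w => linked a b -> Pw a b w)) => b.
  have [|] := boolP (linked a b); last by exists [::].
  case/andP=> _ /existsP[K PK]; have /and4P[fK /eqP KU aN bN] := PK.
  by have [p [pp lp sp]] := walk_through fK KU aN bN; exists p => _; exists K.
apply: (van_kampen_walks vk (w := w)) => [a b /wP[K []] //|a b c d].
move=> Lab Lcd; have [K [/and4P[fK /eqP KU aN bN] _ _ wK]] := wP _ _ Lab.
have [L [/and4P[fL /eqP LU cN dN] _ _ wL]] := wP _ _ Lcd.
move=> ac ad bc bd.
have /fragP[_ _ NKU _ cK] := fK; have /fragP[_ _ NLU _ cL] := fL.
have KL0 : K :&: L = set0.
  apply: (frag_card fK); rewrite ?subsetIl ?boundaryI_sub //.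
  have sub : N (K :&: L) \subset N K :&: N L.
    apply/subsetP => y /boundaryI; rewrite in_setI => /or3P[] /andP[y1 y2] //.
      by have := in_set0 y; rewrite -LU in_setI y2 (subsetP NKU).
    by have := in_set0 y; rewrite -KU in_setI y1 (subsetP NLU).
  apply: leq_trans (subset_leq_card sub) _; rewrite leqNgt; apply/negP => gt2.
  have KL : N K = N L.
    have /eqP E1 : N K :&: N L == N K by rewrite eqEcard subsetIl cK.
    by have /eqP <- : N K :&: N L == N L by rewrite eqEcard subsetIr cL.
  have uniq4 : uniq [:: a; b; c; d].
    rewrite /= !inE !negb_or ac ad bc bd /= !andbT.
    by case/andP: Lab => ->; case/andP: Lcd => ->.
  have : #|[:: a; b; c; d]| <= #|N K|.
    apply/subset_leq_card/subsetP => y.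
    by rewrite !in_cons in_nil orbF => /or4P[] /eqP-> //; rewrite KL.
  by rewrite (card_uniqP uniq4) cK.
have NKL y : y \in N K -> y \notin L.
  by move=> yN; apply/negP => yL; have := in_set0 y; rewrite -LU in_setI yL (subsetP NKU).
have NLK y : y \in N L -> y \notin K.
  by move=> yN; apply/negP => yL; have := in_set0 y; rewrite -KU in_setI yL (subsetP NLU).
have inK z : z \in a :: w a b -> [\/ z = a, z = b | z \in K].
  rewrite inE => /orP[/eqP->|/wK]; first by constructor 1.
  by rewrite in_setU1 => /orP[/eqP->|]; [constructor 2|constructor 3].
have inL z : z \in c :: w c d -> [\/ z = c, z = d | z \in L].
  rewrite inE => /orP[/eqP->|/wL]; first by constructor 1.
  by rewrite in_setU1 => /orP[/eqP->|]; [constructor 2|constructor 3].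
rewrite disjoint_has; apply/hasPn => z /inK zK; apply/negP => /inL zL.
case: zK => [zE|zE|zK]; case: zL => [zF|zF|zL].
- by move: ac; rewrite -zE zF eqxx.
- by move: ad; rewrite -zE zF eqxx.
- by have := NKL _ aN; rewrite -zE zL.
- by move: bc; rewrite -zE zF eqxx.
- by move: bd; rewrite -zE zF eqxx.
- by have := NKL _ bN; rewrite -zE zL.
- by have := NLK _ cN; rewrite -zF zK.
- by have := NLK _ dN; rewrite -zF zK.
- by have := in_set0 z; rewrite -KL0 in_setI zK zL.
Qed.

(** The kept set is [X0], the at most five links of [r], and [Q]. If [r] has neighbours in [X0],
    then [Q] hits the cuts with a side [{x}], [x] in [X0]. Otherwise no such cut contains [r], and
    [Q] secures a kept neighbour of [r] instead. *)
Lemma blocked_not_van_kampen : van_kampen e -> False.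
Proof.
move=> vk; have [A [X0 [[X0U cX0 AW AU0 dAX] sides]]] := small_side_exists.
have noB := no_small_meeting X0U cX0 dAX sides.
have Lsym : symmetric linked.
  move=> a b; rewrite /linked /= eq_sym; congr (_ && _); apply: eq_existsb => K.
  by congr [&& _, _ & _]; exact: andbC.
have Lirr : irreflexive linked by move=> a; rewrite /linked /= eqxx.
have [r rAU cr] := van_kampen_degenerate (van_kampen_linked vk) Lsym Lirr AU0.
have /setIP[rA rU] := rAU.
have rX0 : r \in X0 = false by rewrite (disjointFr dAX rA).
pose T := [set x in X0 | e r x].
pose q x := odflt x [pick p | (p \in N [set x] :&: U) && (p != r)].
have [w0 w0W erw0] := has_nbr rU.
pose Q := if T == set0 then [set w0] :&: U else q @: T.
pose Y := X0 :|: nbrs linked (A :&: U) r :|: Q.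
have qU x : x \in T -> q x \in U /\ q x != r.
  rewrite inE /q => /andP[xX erx]; case: pickP => [p /andP[/setIP[]]|_] //=.
  by rewrite (subsetP X0U) //; split=> //; apply: contraFneq rX0 => <-.
have YU : Y \subset U.
  rewrite !subUset X0U /=; apply/andP; split.
    by apply/subsetP => y; rewrite inE => /andP[/setIP[]].
  rewrite /Q; case: eqP => _; first exact: subsetIr.
  by apply/subsetP => y /imsetP[x /qU[xU _] ->].
have rY : r \notin Y.
  rewrite !in_setU rX0 inE Lirr andbF /= /Q; case: eqP => _.
    by rewrite in_setI in_set1; apply: contraTN erw0 => /andP[/eqP <-]; rewrite irr.
  by apply/imsetP => -[x /qU[_ /eqP xr]] /esym.
have cQ : #|Q| <= 3.
  rewrite /Q; case: eqP => _.
    by apply: leq_trans (subset_leq_card (subsetIl _ _)) _; rewrite cards1.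
  apply: leq_trans (leq_imset_card _ _) (leq_trans (subset_leq_card _) cX0).
  by apply/subsetP => y; rewrite inE => /andP[].
have cY : #|Y| <= 11.
  have c1 := (leq_card_setU X0 (nbrs linked (A :&: U) r)).1.
  have c2 := (leq_card_setU (X0 :|: nbrs linked (A :&: U) r) Q).1.
  by rewrite -/Y in c2; nat_lia.
have [|C [fC rC dC]] := blocked rU YU rY cY.
  have [T0|/set0Pn[x]] := eqVneq T set0.
    exists w0 => //; rewrite erw0 /=; case: (boolP (w0 \in U)) => //= w0U.
    by rewrite !in_setU /Q T0 eqxx in_setI set11 w0U !orbT.
  rewrite inE => /andP[xX erx]; exists x; first exact/(subsetP tou.1)/(subsetP X0U).
  by rewrite erx !in_setU xX !orbT.
have dX0 : [disjoint N C & X0].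
  by apply: disjointWr dC; rewrite /Y -!setUA subsetUl.
have [D [[sD ND DAX D1] alt]] := sides r C rA fC rC dX0.
case: (alt (noB _ sD)) => [[K [p [fK KU rK pK [pC pA pr]]]]|[x xX Dx]].
  have /fragP[_ _ CU _ _] := fC.
  have Lrp : linked r p.
    apply/andP; split; first by rewrite eq_sym.
    by apply/existsP; exists K; rewrite fK KU eqxx rK.
  have pL : p \in nbrs linked (A :&: U) r.
    by rewrite [_ \in _]inE in_setI pA (subsetP CU).
  by have := disjointFr dC pC; rewrite !in_setU pL orbT.
have /andP[fD _] := sD; have /fragP[_ _ DU _ cD] := fD.
have erx : e r x.
  have : r \in N D by rewrite ND.
  by rewrite Dx => /boundary_nbr[y /set1P->].
have xT : x \in T by rewrite inE xX.
have qN : q x \in N D.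
  have [|p pD pr] := @card2_other _ (N D) r; first by rewrite cD.
  rewrite /q; case: pickP => [z /andP[/setIP[zN _] _]|/(_ p)] /=; first by rewrite Dx.
  by rewrite in_setI -Dx pD (subsetP DU) // pr.
have := disjointFr dC (etrans (congr1 (fun S : {set V} => q x \in S) (esym ND)) qN).
rewrite !in_setU /Q ifN ?imset_f ?orbT //; by apply/set0Pn; exists x.
Qed.

End Separations.

(** A separating set of at most two vertices of the new [U] would, with [r] added, be a 3-cut
    through [r] avoiding [Y]. If [#|U| <= 12], then [Y = U :\ r] hits every 3-cut; beyond that
    [blocked_not_van_kampen] supplies [r]. *)
Lemma tough_step (V : finType) (e : rel V) (W U : {set V}) :
  symmetric e -> irreflexive e -> van_kampen e -> tough e W U -> 1 < #|W| ->
  U != set0 ->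
  exists r (Y : {set V}), [/\ r \in U, Y \subset U :\ r, #|Y| <= 11,
    exists2 w, w \in W :\ r & e r w && ((w \notin U) || (w \in Y)) &
    tough e (W :\ r) (U :\: (r |: Y))].
Proof.
move=> sym irr vk tou W1 U0.
pose good (p : V * {set V}) := [&& p.1 \in U, p.2 \subset U, p.1 \notin p.2,
  #|p.2| <= 11 & [exists w in W, e p.1 w && ((w \notin U) || (w \in p.2))]
    && [forall A, fragment e W U A && (p.1 \in boundary e W A) ==>
         ~~ [disjoint boundary e W A & p.2]]].
have [[r Y] /and5P[/= rU YU rY cY /andP[/exists_inP[w wW /andP[erw wUY]] hit]]|none] := pickP good.
  exists r, Y; split=> //; first by rewrite subsetD1 YU.
    by exists w; rewrite ?erw // in_setD1 wW andbT; apply: contraTneq erw => ->; rewrite irr.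
  split.
    apply/subsetP => z; rewrite in_setD in_setU1 negb_or in_setD1 => /andP[/andP[-> _] zU].
    exact: (subsetP tou.1).
  move=> A AW A0 NU E0; rewrite leqNgt; apply/negP => lt3.
  have AW' : A \subset W := subset_trans AW (subsetDl _ _).
  have rA : r \notin A by apply/negP => /(subsetP AW); rewrite in_setD1 eqxx.
  have N1 : boundary e W A \subset r |: boundary e (W :\ r) A.
    apply/subsetP => z /boundaryP[zW zA xP]; rewrite in_setU1.
    by case: eqP => //= /eqP zr; apply/boundaryP; split; rewrite ?in_setD1 ?zr.
  have NUA : boundary e W A \subset U.
    apply: subset_trans N1 _; rewrite subUset sub1set rU.
    exact: subset_trans NU (subsetDl _ _).
  have Ex : exterior e W A != set0.
    case/set0Pn: E0 => z; rewrite !in_exterior in_setD1 => /and3P[/andP[zr zW] zA zN].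
    apply/set0Pn; exists z; rewrite in_exterior zW zA /=.
    apply: contra zN => /(subsetP N1); by rewrite in_setU1 (negPf zr).
  have c3 := tou.2 _ AW' A0 NUA Ex.
  have c3' : #|r |: boundary e (W :\ r) A| <= 3.
    by rewrite cardsU1; case: (r \notin _) => /=; move: lt3; clear; lia.
  have /eqP NE : boundary e W A == r |: boundary e (W :\ r) A.
    by rewrite eqEcard N1; apply: leq_trans c3' c3.
  have /implyP := forallP hit A.
  have -> : fragment e W U A && (r \in boundary e W A).
    rewrite NE in_setU1 eqxx andbT; apply/and5P; split=> //.
    by rewrite eqn_leq c3 NE c3'.
  move=> /(_ isT) /negP[]; apply/pred0P => z /=; apply/negP => /andP[].
  rewrite NE in_setU1 => /orP[/eqP->|/(subsetP NU)]; first by rewrite (negPf rY).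
  by rewrite in_setD in_setU1 negb_or => /andP[/andP[_ /negPf->]].
have [/set0Pn[r rU] small_U] : U != set0 /\ #|U| <= 12.
  split=> //; rewrite leqNgt; apply/negP => U12.
  apply: (blocked_not_van_kampen sym irr tou U12 _ vk) => r Y rU YU rY cY [w wW ew].
  have := none (r, Y); rewrite /good /= rU YU rY cY /=.
  have -> : [exists w in W, e r w && ((w \notin U) || (w \in Y))].
    by apply/exists_inP; exists w.
  move=> /= /negbT; rewrite negb_forall => /existsP[A].
  by rewrite negb_imply negbK => /andP[/andP[fA rA] dA]; exists A.
have [w wW erw] := tough_nbr tou W1 rU.
have := none (r, U :\ r); rewrite /good /= rU subsetDl in_setD1 eqxx /=.
have -> : #|U :\ r| <= 11 by move: small_U; rewrite (cardsD1 r) rU.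
have wr : w != r by apply: contraTneq erw => ->; rewrite irr.
have -> /= : [exists w in W, e r w && ((w \notin U) || (w \in U :\ r))].
  by apply/exists_inP; exists w; rewrite // erw in_setD1 wr; case: (w \in U).
move/negbT; rewrite negb_forall => /existsP[A]; rewrite negb_imply negbK.
case/andP=> /andP[/fragP[_ _ NU _ cN] rN] dA.
have [|p pN pr] := @card2_other _ (boundary e W A) r; first by rewrite cN.
by have := disjointFr dA pN; rewrite in_setD1 pr (subsetP NU).
Qed.

(** The invariant gives each deleted vertex a neighbour in [W :\: U], where nothing is deleted
    later. Each round adds one [r] to [D] and settles at most 12 vertices of [U]. *)
Lemma tough_leaves (V : finType) (e : rel V) (W U : {set V}) :
  symmetric e -> irreflexive e -> van_kampen e -> 1 < #|V| -> tough e W U ->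
  (forall d, d \notin W -> exists2 w, w \in W :\: U & e d w) ->
  exists D : {set V}, [/\ D \subset U, #|U| <= 12 * #|D|, tough e (W :\: D) set0 &
    forall d, d \notin W :\: D -> exists2 w, w \in W :\: D & e d w].
Proof.
move=> sym irr vk V1; have [n] := ubnP #|U|; elim: n W U => // n IH W U.
rewrite ltnS => Un tou dom.
have [U0|U0] := eqVneq U set0.
  exists set0; rewrite sub0set U0 cards0 setD0 -{1}U0; split=> // d /dom[w].
  by rewrite U0 setD0; exists w.
(* If an undecided vertex alone were left, domination would force [W] to be the whole vertex set,
   against [1 < #|V|]. *)
have W1 : 1 < #|W|.
  rewrite ltnNge; apply/negP => le1; case/set0Pn: (U0) => u uU.
  have uW := subsetP tou.1 _ uU.
  have WU : W :\: U = set0.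
    apply/setP => w; rewrite in_setD in_set0; apply/negP => /andP[wU wW].
    move: le1; rewrite (cardsD1 u) uW (cardsD1 w) in_setD1 wW andbT.
    by case: eqP => // wu; rewrite wu uU in wU.
  have : W = setT.
    apply/setP => d; rewrite in_setT; apply: contraT => /dom[w].
    by rewrite WU in_set0.
  by move=> WT; rewrite WT cardsT leqNgt V1 in le1.
have [r [Y [rU YU cY [w wW /andP[erw wUY]] tou']]] := tough_step sym irr vk tou W1 U0.
have rY : r \notin Y by apply/negP => /(subsetP YU); rewrite in_setD1 eqxx.
have cU : #|U| <= #|U :\: (r |: Y)| + 12.
  have := cardsID (r |: Y) U; have := subset_leq_card (subsetIr U (r |: Y)).
  by rewrite cardsU1 rY; move: cY; clear; lia.
have wr : w != r by apply: contraTneq erw => ->; rewrite irr.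
have [||D [DU cD touD domD]] := IH (W :\ r) (U :\: (r |: Y)) _ tou'.
- apply: leq_trans Un; apply/proper_card/properP; split; first exact: subsetDl.
  by exists r; rewrite // in_setD in_setU1 eqxx.
- move=> d; rewrite in_setD1 negb_and negbK => /orP[/eqP->|dW].
    exists w; rewrite // in_setD wW andbT in_setD in_setU1 (negPf wr) /=.
    by case/orP: wUY => [/negPf->|->]; rewrite ?andbF.
  have [z] := dom _ dW; rewrite !inE => /andP[zU zW] edz; exists z => //.
  by rewrite !inE (negPf zU) andbF zW andbT; apply: contraNneq zU => ->.
have WD : W :\ r :\: D = W :\: (r |: D) by rewrite setDDl.
exists (r |: D); rewrite -WD; split=> //.
  by rewrite subUset sub1set rU; exact: subset_trans DU (subsetDl _ _).
have rD : r \notin D.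
  by apply/negP => /(subsetP DU); rewrite in_setD in_setU1 eqxx.
by rewrite cardsU1 rD; move: cU cD; clear; lia.
Qed.

(** * Spanning trees *)

Lemma adj_sym (V : finType) (E : {set {set V}}) : symmetric (adj E).
Proof. by move=> x y; rewrite /adj /= setUC. Qed.

Lemma adj_irr (G : graph) : irreflexive (adj (edges G)).
Proof.
move=> x; rewrite /adj /=; apply/negP => /card_edge.
by rewrite setUid cards1.
Qed.

Lemma connected_onT (V : finType) (E : {set {set V}}) :
  0 < #|V| -> (forall x y, connect (adj E) x y) -> connected_on E setT.
Proof.
move=> V0 con; split; first by rewrite -card_gt0 cardsT.
move=> x y _ _; apply: connect_sub (con x y) => u v uv; apply: connect1.
by rewrite /= !in_setT !andbT.
Qed.

Lemma connected_onTE (V : finType) (E : {set {set V}}) :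
  connected_on E setT -> forall x y, connect (adj E) x y.
Proof.
move=> [_ con] x y; apply: connect_sub (con x y (in_setT _) (in_setT _)) => u v.
by case/and3P=> uv _ _; apply: connect1.
Qed.

Lemma set2_inj (V : finType) (a b x y : V) :
  [set a; b] = [set x; y] -> (a = x /\ b = y) \/ (a = y /\ b = x).
Proof.
move=> E; have /set2P aP : a \in [set x; y] by rewrite -E set21.
have /set2P bP : b \in [set x; y] by rewrite -E set22.
have /set2P xP : x \in [set a; b] by rewrite E set21.
have /set2P yP : y \in [set a; b] by rewrite E set22.
case: aP => a_eq; case: bP => b_eq; subst; auto; [case: yP | case: xP]; auto.
Qed.

(** In a smallest connecting edge set, an edge of a cycle could be bypassed along the rest of the
    cycle. *)
Lemma exists_spanning_tree (G : graph) (E : {set {set G}}) :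
  E \subset edges G -> 0 < #|G| -> (forall x y, connect (adj E) x y) ->
  exists2 T : {set {set G}}, T \subset E & spanning_tree T.
Proof.
move=> EG G0 conE.
pose con (F : {set {set G}}) := (F \subset E) && [forall x, forall y, connect (adj F) x y].
have conE' : con E by rewrite /con subxx; apply/forallP => x; apply/forallP => y; apply: conE.
have [T /andP[TE /forallP conT] minT] := arg_minnP (fun F : {set {set G}} => #|F|) conE'.
have {}conT x y : connect (adj T) x y by exact: (forallP (conT x)).
exists T => //; split; first exact: subset_trans TE EG.
  exact: connected_onT.
case=> [|x [|y [|z s]]] // _ /andP[/=].
case/and3P=> xy yz pz /and4P[]; rewrite !inE !negb_or.
case/and3P=> xny xnz xs /andP[ynz ys] zs us.
pose T' := T :\ [set x; y].
have sub u v : u != y -> v != y -> adj T u v -> adj T' u v.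
  rewrite /adj /= in_setD1 => uy vy ->; rewrite andbT; apply/eqP => /set2_inj.
  by case=> -[? ?]; subst; rewrite eqxx in uy vy.
have xyT' : connect (adj T') y x.
  apply: (@connect_trans _ _ z).
    apply: connect1; move: yz; rewrite /adj /= in_setD1 => ->; rewrite andbT.
    by apply/eqP => /set2_inj[] [? ?]; subst; rewrite eqxx in xny xnz *.
  have -> : x = last z (rcons s x) by rewrite last_rcons.
  apply/connectP; exists (rcons s x) => //.
  apply: (sub_in_path (P := predC1 y)) pz; first by move=> u v; exact: sub.
  rewrite /= all_rcons /= xny [z == y]eq_sym ynz /=; apply/allP => u us'.
  by apply: contraNneq ys => <-.
have sym' : symmetric (adj T') := adj_sym T'.
have conT' a b : connect (adj T') a b.
  apply: connect_sub (conT a b) => u v uv.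
  have [/set2_inj|ne] := eqVneq [set u; v] [set x; y]; last first.
    by apply: connect1; rewrite /adj /= in_setD1 ne.
  by case=> -[-> ->]; rewrite // (sym_connect_sym sym').
have := minT T'; rewrite /con (subset_trans (subsetDl _ _) TE) /=.
have -> : [forall x, forall y, connect (adj T') x y].
  by apply/forallP => a; apply/forallP => b.
move=> /(_ isT); rewrite leqNgt => /negP[].
by rewrite /T' [X in _ < X](cardsD1 [set x; y]) (_ : _ \in T).
Qed.

Lemma k_connected_tough (G : graph) (R : {set G}) :
  k_connected 3 G -> tough (adj (edges G)) setT R.
Proof.
move=> [_ con]; split; first exact: subsetT.
move=> A _ /set0Pn[x xA] _ /set0Pn[y]; rewrite in_exterior => /and3P[_ yA yN].
rewrite leqNgt; apply/negP => lt3; have [_ conA] := con _ lt3.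
have xC : x \in ~: boundary (adj (edges G)) setT A.
  by rewrite in_setC; apply/negP => /boundary_in; rewrite xA.
have yC : y \in ~: boundary (adj (edges G)) setT A by rewrite in_setC.
have /connectP[p] := conA x y xC yC.
elim: p x xA {xC} => [|z p IH] x xA /=; first by move=> _ yx; rewrite yx xA in yA.
case/andP=> /and3P[xz _ zC] pz ly; apply: IH pz ly.
have := boundary_closed xA (in_setT z) xz; case/orP=> // zN.
by rewrite in_setC zN in zC.
Qed.

(** Toughness for the empty set is connectedness of the complement of [D]. Retain the edges there
    and a single edge from each [d] in [D] to [p d]: any spanning tree of this subgraph has [D]
    among its leaves. *)
Lemma spanning_tree_leaves (G : graph) (D : {set G}) :
  1 < #|G| -> tough (adj (edges G)) (~: D) set0 ->
  (forall d, d \in D -> exists2 w, w \notin D & adj (edges G) d w) ->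
  exists2 T : {set {set G}}, spanning_tree T & D \subset leaves T.
Proof.
move=> G1 [_ tou] dom; pose e := adj (edges G).
pose p d := odflt d [pick w | (w \notin D) && e d w].
have pP d : d \in D -> p d \notin D /\ e d (p d).
  by case/dom=> w wD edw; rewrite /p; case: pickP => [z /andP[]//|/(_ w)]; rewrite wD /e edw.
pose E := [set f in edges G | [disjoint f & D]] :|: [set [set d; p d] | d in D].
have EG : E \subset edges G.
  rewrite subUset; apply/andP; split; first by apply/subsetP => f; rewrite inE => /andP[].
  by apply/subsetP => f /imsetP[d /pP[_ edp] ->].
have Esub u v : u \notin D -> v \notin D -> e u v -> adj E u v.
  move=> uD vD euv; rewrite /adj /= in_setU inE; apply/orP; left.
  rewrite (_ : _ \in edges G) //= disjoint_subset; apply/subsetP => z.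
  by rewrite !inE => /orP[]/eqP->.
have EsubD d : d \in D -> adj E d (p d).
  by move=> dD; rewrite /adj /= in_setU; apply/orP; right; apply/imsetP; exists d.
have symE := adj_sym E.
have conW x y : x \notin D -> y \notin D -> connect (adj E) x y.
  move=> xD yD; pose A := [set z in ~: D | connect (adj E) x z].
  have N0 : boundary e (~: D) A = set0.
    apply/setP => z; rewrite in_set0; apply/negP => /boundaryP[zD zA [w]].
    rewrite inE => /andP[wD xw] ewz; case/negP: zA; rewrite inE zD.
    apply: connect_trans xw (connect1 _); move: wD zD; rewrite !in_setC => wD zD.
    exact: Esub.
  have xA : x \in A by rewrite inE in_setC xD connect0.
  have : y \notin exterior e (~: D) A.
    apply/negP => yE; have := tou A; rewrite N0 cards0 sub0set.
    suff : [&& A \subset ~: D, A != set0 & exterior e (~: D) A != set0].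
      by case/and3P=> -> -> -> /(_ isT isT isT isT).
    apply/and3P; split; [|by apply/set0Pn; exists x|by apply/set0Pn; exists y].
    by apply/subsetP => z; rewrite inE => /andP[].
  rewrite in_exterior N0 in_set0 in_setC yD /= andbT negbK inE.
  by case/andP.
have toW x : exists2 w, w \notin D & connect (adj E) x w.
  have [xD|xD] := boolP (x \in D); last by exists x.
  by have [pD _] := pP _ xD; exists (p x) => //; apply: connect1; apply: EsubD.
have conE x y : connect (adj E) x y.
  have [w wD xw] := toW x; have [z zD yz] := toW y.
  apply: connect_trans xw (connect_trans (conW _ _ wD zD) _).
  by rewrite (sym_connect_sym symE).
have [T TE sT] := exists_spanning_tree EG (ltnW G1) conE.
exists T => //; apply/subsetP => d dD; rewrite inE.
have [pD edp] := pP _ dD.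
have sub : [set y | adj T d y] \subset [set p d].
  apply/subsetP => y; rewrite inE in_set1 /adj /= => /(subsetP TE).
  rewrite in_setU => /orP[|/imsetP[d' d'D]].
    by rewrite inE => /andP[_ /disjointFr/(_ (set21 _ _))]; rewrite dD.
  move=> /set2_inj[] [dE yE]; first by rewrite yE dE.
  by have [] := pP _ d'D; rewrite -dE dD.
rewrite eqn_leq -{1}(cards1 (p d)) subset_leq_card //= card_gt0.
have [_ /connected_onTE conT _] := sT.
have /connectP[[|z s]] := conT d (p d).
  by move=> _ /= pd; move: pD; rewrite pd dD.
by case/andP=> dz _ _; apply/set0Pn; exists z; rewrite inE.
Qed.

Local Open Scope ring_scope.

Lemma robust_connectivity_lower (R : realType) (G : graph) :
  k_connected 3 G -> van_kampen (adj (edges G)) ->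
  21 / 256 <= robust_connectivity R G.
Proof.
move=> con vk; apply/bigmin_geP; split; first lra.
move=> S S0; have G1 : (1 < #|G|)%N by case: con => lt _; apply: leq_trans lt.
have dom0 (d : G) : d \notin [set: G] -> exists2 w, w \in setT :\: S & adj (edges G) d w.
  by rewrite in_setT.
have [D [DS cD touD domD]] := tough_leaves (adj_sym _) (@adj_irr G) vk G1
  (k_connected_tough S con) dom0.
rewrite setTD in touD domD.
have [d dD|T sT DT] := spanning_tree_leaves G1 touD.
  have [|w wD edw] := domD d; first by rewrite in_setC negbK.
  by exists w; rewrite // -in_setC.
apply: (@le_trans _ _ (#|S :&: leaves T|%:R / #|S|%:R)); last first.
  by apply: le_bigmax_cond; apply/asboolP.
have cS : (#|S| <= 12 * #|S :&: leaves T|)%N.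
  apply: leq_trans cD _; rewrite leq_mul2l /=; apply: subset_leq_card.
  by rewrite subsetI DS.
have S1 : (0 < #|S|)%N by rewrite card_gt0.
rewrite ler_pdivlMr ?ltr0n //.
have : (#|S|%:R <= 12 * #|S :&: leaves T|%:R :> R) by rewrite -natrM ler_nat.
have : (0 <= #|S :&: leaves T|%:R :> R) by exact: ler0n.
lra.
Qed.

(** * Plane embeddings satisfy the mod 2 equations *)

(** Half-open, so that it contains exactly one of [w] and [- w] for nonzero [w]; this covers
    horizontal directions too. *)
Definition upper_half (R : realDomainType) (w : R * R) : bool :=
  (0 < w.2) || (w.2 == 0) && (0 < w.1).

(* For [w] and [w'] in a common half-plane, the parity of the crossings of the
   positive first axis by the segment from [w] to [w']. *)
Definition axis_cross (R : realDomainType) (w w' : R * R) : bool :=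
  (0 < w.1) && (upper_half w (+) upper_half w').

Definition half_plane (R : realDomainType) (P : R * R -> Prop) : Prop :=
  [\/ forall w, P w -> 0 < w.1, forall w, P w -> w.1 < 0,
      forall w, P w -> 0 < w.2 | forall w, P w -> w.2 < 0].

Lemma upper_half_pos (R : realDomainType) (w : R * R) : 0 < w.2 -> upper_half w.
Proof. by rewrite /upper_half => ->. Qed.

Lemma upper_half_neg (R : realDomainType) (w : R * R) : w.2 < 0 -> upper_half w = false.
Proof. by rewrite /upper_half => w0; rewrite lt_gtF // lt_eqF. Qed.

Lemma upper_halfN (R : realDomainType) (w w' : R * R) : w != w' ->
  upper_half (w - w') = ~~ upper_half (w' - w).
Proof.
case: w w' => [a b] [c d]; rewrite xpair_eqE /upper_half /= !subr_gt0 !subr_eq0.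
case: (ltgtP d b); case: (ltgtP a c); rewrite ?andbF ?andbT ?orbF ?eqxx //=.
Qed.

(** A closed quadrilateral in a half-plane missing the origin crosses the ray an even number of
    times. *)
Lemma axis_cross_square (R : realDomainType) (P : R * R -> Prop) w00 w01 w10 w11 :
  half_plane P -> P w00 -> P w01 -> P w10 -> P w11 ->
  axis_cross w00 w10 (+) axis_cross w01 w11 =
  axis_cross w00 w01 (+) axis_cross w10 w11.
Proof.
rewrite /axis_cross => hP P00 P01 P10 P11; case: hP => H.
- by rewrite !H //=; xor_ring.
- by rewrite !(lt_gtF (H _ _)).
- by rewrite !(upper_half_pos (H _ _)) // !andbF.
- by rewrite !(upper_half_neg (H _ _)) // !andbF.
Qed.

(** Negation exchanges the positive and the negative first axis, and the crossings of both together
    are the changes of upper half. *)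
Lemma axis_crossN (R : realDomainType) (P : R * R -> Prop) (a b c d : R * R) :
  half_plane P -> P (a - b) -> P (c - d) -> a != b -> c != d ->
  axis_cross (a - b) (c - d) (+) axis_cross (b - a) (d - c) =
  upper_half (a - b) (+) upper_half (c - d).
Proof.
move=> hP Pw Pw' ab cd; rewrite /axis_cross.
rewrite (upper_halfN (w := b)) 1?eq_sym // (upper_halfN (w := d)) 1?eq_sym //.
have E : (b - a).1 = - (a - b).1 by rewrite /= opprB.
rewrite E oppr_gt0; case: hP => H.
- by rewrite H // lt_gtF ?H //=; xor_ring.
- by rewrite lt_gtF ?H //=; xor_ring.
- by rewrite !upper_half_pos ?H //= !andbF.
- by rewrite !upper_half_neg ?H //= !andbF.
Qed.

Definition winding (R : realDomainType) (n : nat) (a : nat -> R * R) (v : R * R) : bool :=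
  \big[addb/false]_(i < n) axis_cross (a i - v) (a i.+1 - v).

(** Take the grid of differences [a i - b j]. Its boundary crosses the ray evenly because each cell
    does. Two sides are windings of [a]; the other two become windings of [b] after a sign change,
    which contributes the [upper_half] terms. *)
Lemma winding_rectangle (R : realDomainType) (n : nat) (a b : nat -> R * R) :
  (forall i j, (i <= n)%N -> (j <= n)%N -> a i != b j) ->
  (forall i j, (i < n)%N -> (j < n)%N -> exists2 P, half_plane P &
     forall i' j', (i <= i' <= i.+1)%N -> (j <= j' <= j.+1)%N -> P (a i' - b j')) ->
  winding n a (b 0%N) (+) winding n a (b n) (+)
    winding n b (a 0%N) (+) winding n b (a n) =
  upper_half (a 0%N - b 0%N) (+) upper_half (a 0%N - b n) (+)
    upper_half (a n - b 0%N) (+) upper_half (a n - b n).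
Proof.
move=> ab tame.
pose col m i := \big[addb/false]_(j < m) axis_cross (a i - b j) (a i - b j.+1).
have row m i : (i < n)%N -> (m <= n)%N ->
    axis_cross (a i - b 0%N) (a i.+1 - b 0%N) (+) axis_cross (a i - b m) (a i.+1 - b m) =
    col m i (+) col m i.+1.
  move=> i_n; elim: m => [|m IH] m_n; first by rewrite /col !big_ord0 addbb.
  rewrite /col !big_ord_recr /= -!/(col _ _); have E1 := IH (ltnW m_n).
  have [P hP PP] := tame i m i_n m_n.
  have E2 := axis_cross_square hP (PP i m _ _) (PP i m.+1 _ _) (PP i.+1 m _ _) (PP i.+1 m.+1 _ _).
  rewrite !leqnn !leqnSn in E2; have {}E2 := E2 isT isT isT isT isT isT isT isT.
  by apply: (addb_eqD E1 E2); xor_ring.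
have grid m : (m <= n)%N -> winding m a (b 0%N) (+) winding m a (b n) = col n 0%N (+) col n m.
  elim: m => [|m IH] m_n; first by rewrite /winding !big_ord0 !addbb.
  rewrite /winding !big_ord_recr /= -!/(winding _ _ _).
  have E1 := IH (ltnW m_n); have E2 := row n m m_n (leqnn n).
  by apply: (addb_eqD E1 E2); xor_ring.
have side i m : (i <= n)%N -> (m <= n)%N -> (0 < n)%N -> col m i (+) winding m b (a i) =
    upper_half (a i - b 0%N) (+) upper_half (a i - b m).
  move=> i_n m_n n0; elim: m m_n => [|m IH] m_n; first by rewrite /col /winding !big_ord0 !addbb.
  rewrite /col /winding !big_ord_recr /= -/(winding _ _ _) -/(col _ _).
  have E1 := IH (ltnW m_n).
  have [i' i'_n ii'] : exists2 i', (i' < n)%N & (i' <= i <= i'.+1)%N.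
    have [lt|ge] := ltnP i n; first by exists i; rewrite // leqnn leqnSn.
    by exists n.-1; lia.
  have [P hP PP] := tame i' m i'_n m_n.
  have E2 := axis_crossN hP (PP i m _ _) (PP i m.+1 _ _) (ab i m _ _) (ab i m.+1 _ _).
  rewrite !leqnn !leqnSn ii' i_n (ltnW m_n) m_n in E2.
  have {}E2 := E2 isT isT isT isT isT isT isT isT.
  by apply: (addb_eqD E1 E2); xor_ring.
have [n0|n0] := posnP n; first by rewrite n0 /winding !big_ord0 !addbb.
have E0 := side 0%N n (leq0n n) (leqnn n) n0; have En := side n n (leqnn n) (leqnn n) n0.
have Eg := grid n (leqnn n).
have E : col n 0%N (+) winding n b (a 0%N) (+) (col n n (+) winding n b (a n)) =
  upper_half (a 0%N - b 0%N) (+) upper_half (a 0%N - b n) (+)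
  (upper_half (a n - b 0%N) (+) upper_half (a n - b n)) by rewrite E0 En.
by apply: (addb_eqD Eg E); xor_ring.
Qed.

Local Open Scope classical_set_scope.
Local Open Scope ring_scope.

Lemma curve_local (R : realType) (g : R -> R * R) (s eta : R) :
  {within `[0, 1], continuous g} -> s \in `[0, 1] -> 0 < eta ->
  exists2 eps, 0 < eps & forall t, t \in `[0, 1] -> `|t - s| < eps ->
    `|(g t).1 - (g s).1| < eta /\ `|(g t).2 - (g s).2| < eta.
Proof.
move=> /subspace_continuousP cg s01 eta0.
have : nbhs (g s) [set w : R * R | `|w.1 - (g s).1| < eta /\ `|w.2 - (g s).2| < eta].
  exists ([set x | `|x - (g s).1| < eta], [set y | `|y - (g s).2| < eta]) => /=.
    by split; apply/nbhs_ballP; exists eta => //= z; rewrite /ball /= distrC.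
  by move=> [x y] /= [].
move/(cg s _) => /= /(_ s01).
rewrite /= nbhs_simpl /within /= => /nbhs_ballP[eps /= eps0 H]; exists eps => // t t01 ts.
by apply: H => //; rewrite /ball /= distrC.
Qed.

(** Near each pair of parameters some coordinate of the difference keeps a strict sign, and
    compactness of the square makes the scale uniform. *)
Lemma curves_tame (R : realType) (g g' : R -> R * R) :
  {within `[0, 1], continuous g} -> {within `[0, 1], continuous g'} ->
  (forall s t, s \in `[0, 1] -> t \in `[0, 1] -> g s != g' t) ->
  exists n0 : nat, forall n, (n0 <= n)%N -> (0 < n)%N ->
    forall s t, s \in `[0, 1] -> t \in `[0, 1] ->
    half_plane (fun w : R * R => exists s' t', [/\ s' \in `[0, 1], t' \in `[0, 1],
      `|s' - s| <= n%:R^-1, `|t' - t| <= n%:R^-1 & w = g s' - g' t']).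
Proof.
move=> cg cg' gg'.
pose K : set (R * R) := (`[0, 1] `*` `[0, 1]).
have cK : compact K by apply: compact_setX; exact: segment_compact.
pose P (n : nat) (p : R * R) := K p -> (0 < n)%N ->
  half_plane (fun w : R * R => exists s' t', [/\ s' \in `[0, 1], t' \in `[0, 1],
      `|s' - p.1| <= n%:R^-1, `|t' - p.2| <= n%:R^-1 & w = g s' - g' t']).
have /compact_near_coveringP nc := cK.
have [[s0 t0] [/= s01 t01]|n0 _ Hn] := nc nat \oo P _.
  (* Half the distance in one coordinate: two points each moving by less than [eta] cannot close the
     gap. *)
  have [eta eta0 Heta] : exists2 eta, 0 < eta &
      eta *+ 2 <= `|(g s0).1 - (g' t0).1| \/ eta *+ 2 <= `|(g s0).2 - (g' t0).2|.
    have : g s0 != g' t0 by apply: gg'.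
    rewrite -subr_eq0; case: (g s0) (g' t0) => [a b] [c d]; rewrite xpair_eqE negb_and /=.
    case/orP => ne; [exists (`|a - c| / 2)|exists (`|b - d| / 2)].
    - by rewrite divr_gt0 ?normr_gt0.
    - by left; rewrite mulr2n -splitr.
    - by rewrite divr_gt0 ?normr_gt0.
    - by right; rewrite mulr2n -splitr.
  have [e1 e10 H1] := curve_local cg s01 eta0.
  have [e2 e20 H2] := curve_local cg' t01 eta0.
  pose e := Num.min e1 e2 / 2.
  have e0 : 0 < e by rewrite divr_gt0 // lt_min e10 e20.
  have nb : \forall p' \near (s0, t0) & n \near \oo, `|p'.1 - s0| < e /\ `|p'.2 - t0| < e /\ n%:R^-1 < e.
    exists ([set p' : R * R | `|p'.1 - s0| < e /\ `|p'.2 - t0| < e],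
            [set n : nat | n%:R^-1 < e]) => /=; last by move=> [p n] /= [[]].
    split; last first.
      have := nbhs_infty_gtr e^-1; apply: filterS => n /= en.
      by rewrite invf_plt // posrE // (lt_trans _ en) // invr_gt0.
    exists ([set x | `|x - s0| < e], [set y | `|y - t0| < e]); last by move=> [x y] [].
    by split; apply/nbhs_ballP; exists e => //= z; rewrite /ball /= distrC.
  apply: filterS nb => -[[s t] n] /= [ps [pt ne]] [/= s1 t1] n0.
  have tri (x y z : R) : `|x - y| < e -> `|z - x| <= n%:R^-1 -> `|z - y| < e *+ 2.
    move=> xy zx; have -> : z - y = (x - y) + (z - x) by rewrite [RHS]addrC addrA subrK.
    rewrite mulr2n.
    by apply: le_lt_trans (ler_normD _ _) _; apply: ltrD => //; apply: le_lt_trans ne.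
  have e1e : e *+ 2 <= e1 by rewrite mulr2n -splitr ge_min lexx.
  have e2e : e *+ 2 <= e2 by rewrite mulr2n -splitr ge_min lexx orbT.
  have far (x x0 y y0 : R) : `|x - x0| < eta -> `|y - y0| < eta -> eta *+ 2 <= `|x0 - y0| ->
      if 0 < x0 - y0 then 0 < x - y else x - y < 0.
    by rewrite !ltr_norml => /andP[? ?] /andP[? ?]; rewrite ler_normr mulr2n; case: ifP => ?; case/orP; lra.
  have close s' t' : s' \in `[0, 1] -> t' \in `[0, 1] -> `|s' - s| <= n%:R^-1 -> `|t' - t| <= n%:R^-1 ->
      [/\ `|(g s').1 - (g s0).1| < eta, `|(g s').2 - (g s0).2| < eta,
          `|(g' t').1 - (g' t0).1| < eta & `|(g' t').2 - (g' t0).2| < eta].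
    move=> s'01 t'01 /(tri _ _ _ ps) ss /(tri _ _ _ pt) tt.
    have [? ?] := H1 _ s'01 (lt_le_trans ss e1e).
    by have [? ?] := H2 _ t'01 (lt_le_trans tt e2e).
  case: Heta => far0.
    have [pos|neg] := boolP (0 < (g s0).1 - (g' t0).1); [constructor 1|constructor 2];
      move=> w [s' [t' [s'01 t'01 ss tt ->]]]; have [h1 h2 h3 h4] := close _ _ s'01 t'01 ss tt;
      by have := far _ _ _ _ h1 h3 far0; rewrite ?pos ?(negPf neg).
  have [pos|neg] := boolP (0 < (g s0).2 - (g' t0).2); [constructor 3|constructor 4];
    move=> w [s' [t' [s'01 t'01 ss tt ->]]]; have [h1 h2 h3 h4] := close _ _ s'01 t'01 ss tt;
    by have := far _ _ _ _ h2 h4 far0; rewrite ?pos ?(negPf neg).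
exists n0 => n /Hn Pn n1 s t s01 t01; exact: (Pn (s, t)).
Qed.

Lemma segment_cases (R : realType) (s : R) :
  s \in `[0, 1] -> [\/ s = 0, s = 1 | s \in `]0, 1[].
Proof.
rewrite !in_itv /= => /andP[]; rewrite le_eqVlt => /orP[/eqP<-|s0]; first by constructor 1.
rewrite le_eqVlt => /orP[/eqP->|s1]; first by constructor 2.
by constructor 3; rewrite s0.
Qed.

Section PlaneEmbedding.

Variables (R : realType) (G : graph) (pos : G -> R * R) (gamma : {set G} -> R -> R * R).
Hypothesis emb : plane_embedding pos gamma.

Lemma arc_end (e : {set G}) (s : R) : e \in edges G -> s = 0 \/ s = 1 ->
  exists2 x, x \in e & gamma e s = pos x.
Proof.
case: emb => _ arcs _ /arcs[_ _ ends _] s01.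
have : [set gamma e z | z in [set 0; 1]] (gamma e s).
  by exists s.
by rewrite ends => -[x /= xe <-]; exists x.
Qed.

Lemma arcs_disjoint (e f : {set G}) (s t : R) : e \in edges G -> f \in edges G ->
  [disjoint e & f]%B -> s \in `[0, 1] -> t \in `[0, 1] -> gamma e s != gamma f t.
Proof.
move=> eE fE def s01 t01; apply/eqP => E; case: emb => inj arcs cross.
have [_ _ _ e_pos] := arcs _ eE; have [_ _ _ f_pos] := arcs _ fE.
have inner (g : {set G}) u x : [set gamma g z | z in `]0, 1[] `&` range pos = classical_sets.set0 ->
    u \in `]0, 1[ -> gamma g u = pos x -> False.
  move=> g0 u01 gu; suff : (classical_sets.set0 : set (R * R)) (pos x) by [].
  by rewrite -g0; split; [exists u|exists x].
have ne : e != f.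
  apply/eqP => ef; rewrite ef in def eE; have := card_edge eE.
  have [x xf _] := arc_end fE (or_introl (erefl 0)).
  by have := disjointFr def xf; rewrite xf.
case/segment_cases: (s01) => [s0|s1|s_in]; case/segment_cases: (t01) => [t0|t1|t_in].
all: try (have [x xe ex] := arc_end eE (or_introl s0));
  try (have [x xe ex] := arc_end eE (or_intror s1));
  try (have [y yf fy] := arc_end fE (or_introl t0));
  try (have [y yf fy] := arc_end fE (or_intror t1)).
all: try by move: E; rewrite ex fy => /inj xy; have := disjointFr def xe; rewrite xy yf.
all: try by apply: (inner f t x f_pos t_in); rewrite -E.
all: try by apply: (inner e s y e_pos s_in); rewrite E.
suff : (classical_sets.set0 : set (R * R)) (gamma e s) by [].
by rewrite -(cross e f eE fE ne); split; [exists s|exists t; rewrite // E].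
Qed.

(** An arc may run in either direction; the parameter is reversed unless the arc starts at [x]. *)
Let edge_param (x y : G) (n i : nat) : R :=
  (if gamma [set x; y]%SET 0 == pos x then i else (n - i)%N)%:R / n%:R.

Let sample (x y : G) (n i : nat) : R * R :=
  gamma [set x; y]%SET (edge_param x y n i).

Lemma edge_param01 x y n i : (0 < n)%N -> (i <= n)%N -> edge_param x y n i \in `[0, 1].
Proof.
move=> n0 i_n; rewrite in_itv /= /edge_param divr_ge0 ?ler0n //=.
rewrite ler_pdivrMr ?ltr0n // mul1r ler_nat; case: ifP => _ //; exact: leq_subr.
Qed.

Lemma edge_param_step x y n i i' : (0 < n)%N -> (i < n)%N -> (i <= i' <= i.+1)%N ->
  `|edge_param x y n i' - edge_param x y n i| <= n%:R^-1.
Proof.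
move=> n0 i_n /andP[ii i'i]; rewrite /edge_param -mulrBl normrM normfV.
rewrite -[`|n%:R|]/(`|n%:R : R|) normr_nat ler_piMl ?invr_ge0 ?ler0n //.
have [->|->] : i' = i \/ i' = i.+1 by lia.
  by rewrite subrr normr0.
case: ifP => _; first by rewrite -natrB // subSnn normr1.
by rewrite distrC -natrB; [rewrite (_ : _ - _ = 1)%N ?normr1 //; lia | lia].
Qed.

Lemma sample_ends x y n : (0 < n)%N -> [set x; y]%SET \in edges G ->
  sample x y n 0 = pos x /\ sample x y n n = pos y.
Proof.
move=> n0 eE; rewrite /sample /edge_param; set e := [set x; y]%SET in eE *.
have n_n : n%:R / n%:R = 1 :> R by rewrite divff // pnatr_eq0 -lt0n.
have [u ue g0] := arc_end eE (or_introl (erefl 0)).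
have [v ve g1] := arc_end eE (or_intror (erefl 1)).
have uv : u != v.
  case: emb => _ arcs _; have [_ inj _ _] := arcs _ eE.
  apply/eqP => uv; have /eqP : (0 : R) = 1; last by rewrite eq_sym oner_eq0.
  by apply: inj; rewrite ?in_itv /= ?lexx ?ler01 // g0 g1 uv.
have xy : x != y.
  by apply/eqP => xy; have := card_edge eE; rewrite /e xy finset.setUid cards1.
case: emb => inj _ _.
move: ue ve uv; rewrite !in_set2 => /orP[]/eqP ux /orP[]/eqP vx; rewrite ux vx ?eqxx // => _.
  by rewrite g0 ux eqxx mul0r n_n g0 g1 ux vx.
have -> : (gamma e 0 == pos x) = false by rewrite g0 ux (inj_eq inj) eq_sym (negPf xy).
by rewrite subn0 subnn mul0r n_n g0 g1 ux vx.
Qed.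

Lemma plane_embedding_van_kampen : van_kampen (adj (edges G)).
Proof.
have tame (e f : {set G}) : exists n0 : nat, e \in edges G -> f \in edges G ->
    [disjoint e & f]%B -> forall n, (n0 <= n)%N -> (0 < n)%N ->
    forall s t, s \in `[0, 1] -> t \in `[0, 1] ->
    half_plane (fun w : R * R => exists s' t', [/\ s' \in `[0, 1], t' \in `[0, 1],
      `|s' - s| <= n%:R^-1, `|t' - t| <= n%:R^-1 & w = gamma e s' - gamma f t']).
  have [/and3P[eE fE ef]|no] := boolP [&& e \in edges G, f \in edges G & [disjoint e & f]%B].
    case: emb => _ arcs _; have [ce _ _ _] := arcs _ eE; have [cf _ _ _] := arcs _ fE.
    have [|n0 H] := curves_tame ce cf; last by exists n0 => _ _ _; apply: H.
    by move=> s t; apply: arcs_disjoint.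
  by exists 0%N => eE fE ef; rewrite eE fE ef in no.
have {}tame (e : {set G}) := fin_all_exists (tame e).
have {tame}[n0 tame] := fin_all_exists tame.
(* One positive sampling rate, fine enough for all pairs of edges. *)
pose n := (\max_(e : {set G}) \max_(f : {set G}) n0 e f).+1.
have n_ge e f : (n0 e f <= n)%N.
  apply: leqW; apply: leq_trans (leq_bigmax e); exact: leq_bigmax.
exists (fun x y v => winding n (sample x y n) (pos v)), (fun x y => upper_half (pos x - pos y)).
case: (emb) => inj _ _; split=> [x y xy|a b c d ab cd ac ad bc bd].
  by apply: upper_halfN; rewrite (inj_eq inj).
have def : [disjoint [set a; b]%SET & [set c; d]%SET]%B.
  rewrite disjoint_subset; apply/fintype.subsetP => z; rewrite !inE.
  by case/orP=> /eqP->; rewrite negb_or ?ac ?ad ?bc ?bd.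
have [a0 an] := sample_ends (ltn0Sn _ : 0 < n)%N ab.
have [c0 cn] := sample_ends (ltn0Sn _ : 0 < n)%N cd.
rewrite -a0 -an -c0 -cn; apply: winding_rectangle => [i j i_n j_n|i j i_n j_n].
  by apply: arcs_disjoint => //; apply: edge_param01.
exists (fun w : R * R => exists s' t', [/\ s' \in `[0, 1], t' \in `[0, 1],
  `|s' - edge_param a b n i| <= n%:R^-1, `|t' - edge_param c d n j| <= n%:R^-1 &
   w = gamma [set a; b]%SET s' - gamma [set c; d]%SET t']).
  by apply: (tame _ _ ab cd def n) => //; apply: edge_param01 => //; exact: ltnW.
move=> i' j' ii jj; exists (edge_param a b n i'), (edge_param c d n j').
by split=> //; [apply: edge_param01 => //; lia|apply: edge_param01 => //; lia
  |exact: edge_param_step|exact: edge_param_step].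
Qed.

End PlaneEmbedding.

(** * The closed ladder *)

Definition book_arc (R : realType) (a b : nat) (up : bool) (t : R) : R * R :=
  let x := a%:R + t * (b%:R - a%:R) in (x, (-1) ^+ up * ((x - a%:R) * (b%:R - x))).

Definition book_drawing (R : realType) (G : graph) (p : G -> nat)
    (page : nat -> nat -> bool) (e : {set G}) : R -> R * R :=
  if [pick xy : G * G | (p xy.1 < p xy.2)%N && (e == [set xy.1; xy.2]%SET)] is Some xy
  then book_arc (p xy.1) (p xy.2) (page (p xy.1) (p xy.2)) else fun=> 0.

Lemma book_drawingP (R : realType) (G : graph) (p : G -> nat) page (e : {set G}) :
  injective p -> e \in edges G -> exists x y : G, [/\ (p x < p y)%N, e = [set x; y]%SET &
    book_drawing p page e = book_arc (p x) (p y) (page (p x) (p y)) :> (R -> R * R)].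
Proof.
move=> inj eE; rewrite /book_drawing; case: pickP => [[x y] /= /andP[xy /eqP ->]|no].
  by exists x, y.
have /eqP/cards2P[x [y [xy exy]]] := card_edge eE.
have [lt|gt|/inj/eqP] := ltngtP (p x) (p y); last by rewrite (negPf xy).
  by have := no (x, y); rewrite /= lt exy eqxx /=.
by have := no (y, x); rewrite /= gt exy finset.setUC eqxx /=.
Qed.

Lemma book_arc_inside (R : realType) (a b : nat) (t : R) : (a < b)%N -> t \in `]0, 1[ ->
  let x := a%:R + t * (b%:R - a%:R) in a%:R < x /\ x < b%:R.
Proof.
rewrite -(ltr_nat R) in_itv /= => ab /andP[t0 t1]; split; nra.
Qed.

(* Arcs on the same page are parabolas over their spans, and the parabola over
   the larger of two nested spans lies strictly above the other one. *)
Lemma book_arcs_cross (R : realType) (a b c d : nat) (up up' : bool) (t t' : R) :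
  (a < b)%N -> (c < d)%N -> t \in `]0, 1[ -> t' \in `]0, 1[ ->
  book_arc a b up t = book_arc c d up' t' ->
  up = up' /\ [\/ (a == c) && (b == d), (a < c)%N && (c < b)%N && (b < d)%N
               | (c < a)%N && (a < d)%N && (d < b)%N].
Proof.
move=> ab cd t01 t'01; have [ax xb] := book_arc_inside ab t01.
have [cx xd] := book_arc_inside cd t'01; rewrite /book_arc.
move: (a%:R + _) (c%:R + _) ax xb cx xd => x x' ax xb cx xd [xx]; rewrite -xx in cx xd *.
have p1 : 0 < (x - a%:R) * (b%:R - x) by rewrite mulr_gt0 // subr_gt0.
have p2 : 0 < (x - c%:R) * (d%:R - x) by rewrite mulr_gt0 // subr_gt0.
move=> E; have [uu E'] : up = up' /\
    (x - a%:R) * (b%:R - x) = (x - c%:R) * (d%:R - x).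
  by move: E; case: up; case: up'; rewrite ?expr0 ?expr1 ?mul1r ?mulN1r => E;
    split=> //; lra.
split=> //.
have cb : (c < b)%N by rewrite -(ltr_nat R); exact: lt_trans cx xb.
have ad : (a < d)%N by rewrite -(ltr_nat R); exact: lt_trans ax xd.
have nest (u v w z : nat) : v%:R < x -> x < z%:R -> (u <= v)%N -> (z <= w)%N ->
    (x - u%:R) * (w%:R - x) = (x - v%:R) * (z%:R - x) -> (u == v) && (w == z).
  move=> vx xz; rewrite -(ler_nat R) -[(z <= w)%N](ler_nat R) -!(eqr_nat R).
  move: u%:R v%:R w%:R z%:R vx xz => u' v' w' z' vx xz uv zw EE.
  by apply/andP; split; rewrite eq_le ?uv ?zw ?andbT /= leNgt; apply/negP => ?; nra.
have [ac|ca|ac] := ltngtP a c; have [bd|db|bd] := ltngtP b d.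
- by constructor 2; rewrite cb.
- by have := nest _ _ _ _ cx xd (ltnW ac) (ltnW db) E'; rewrite (ltn_eqF ac).
- by have := nest _ _ _ _ cx xd (ltnW ac) (eq_leq (esym bd)) E'; rewrite (ltn_eqF ac).
- by have := nest _ _ _ _ ax xb (ltnW ca) (ltnW bd) (esym E'); rewrite (ltn_eqF ca).
- by constructor 3; rewrite ad.
- by have := nest _ _ _ _ ax xb (ltnW ca) (eq_leq bd) (esym E'); rewrite (ltn_eqF ca).
- by have := nest _ _ _ _ ax xb (eq_leq (esym ac)) (ltnW bd) (esym E'); rewrite (gtn_eqF bd) andbF.
- by have := nest _ _ _ _ cx xd (eq_leq ac) (ltnW db) E'; rewrite (gtn_eqF db) andbF.
- by constructor 1.
Qed.

(** With vertices on a line and edges drawn as parabolas above or below it, two arcs can meet inside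
    only if their spans interleave on the same page. *)
Lemma book_embedding_planar (R : realType) (G : graph) (p : G -> nat)
    (page : nat -> nat -> bool) :
  injective p ->
  (forall x y z w : G, [set x; y]%SET \in edges G -> [set z; w]%SET \in edges G ->
     (p x < p z)%N -> (p z < p y)%N -> (p y < p w)%N ->
     page (p x) (p y) != page (p z) (p w)) ->
  planar R G.
Proof.
move=> inj nocross; pose pos (x : G) : R * R := ((p x)%:R, 0).
exists pos, (book_drawing p page); split.
- by move=> x y [/eqP]; rewrite eqr_nat => /eqP/inj.
- move=> e eE; have [x [y [xy exy ->]]] := book_drawingP R page inj eE.
  have arc0 : book_arc (p x) (p y) (page (p x) (p y)) 0 = pos x.
    by rewrite /book_arc mul0r addr0 subrr mul0r mulr0.
  have arc1 : book_arc (p x) (p y) (page (p x) (p y)) 1 = pos y.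
    by rewrite /book_arc mul1r addrC subrK subrr !mulr0.
  have xyR : (p x)%:R < (p y)%:R :> R by rewrite ltr_nat.
  split.
  + apply: continuous_subspaceT => t.
    have cx : {for t, continuous (fun t : R => (p x)%:R + t * ((p y)%:R - (p x)%:R))}.
      by apply: cvgD; [exact: cvg_cst|apply: cvgM; [exact: cvg_id|exact: cvg_cst]].
    have cy : {for t, continuous (fun t : R => (book_arc (p x) (p y) (page (p x) (p y)) t).2)}.
      apply: cvgM; first exact: cvg_cst.
      by apply: cvgM; apply: cvgB => //; exact: cvg_cst.
    exact: (cvg_pair cx cy).
  + move=> s t _ _ [/addrI /mulIf E _]; apply: E.
    by rewrite subr_eq0 gt_eqF.
  + rewrite exy; apply/seteqP; split => w.
      by move=> [t [->|->] <-]; [exists x|exists y]; rewrite ?arc0 ?arc1 //= !inE eqxx ?orbT.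
    by move=> [z /= /set2P[] -> <-]; [exists 0|exists 1]; rewrite ?arc0 ?arc1 //; [left|right].
  + apply/seteqP; split => // w [[t t01 <-] [z _]] [_].
    have [ax xb] := book_arc_inside xy t01.
    move/esym/eqP; rewrite mulf_eq0 signr_eq0 mulf_eq0 /=.
    by rewrite gt_eqF ?subr_gt0 // gt_eqF ?subr_gt0.
- move=> e f eE fE ef; apply/seteqP; split => // w [[t t01 <-] [t' t'01]].
  have [x [y [xy exy ->]]] := book_drawingP R page inj eE.
  have [x' [y' [x'y' fxy ->]]] := book_drawingP R page inj fE.
  case/esym/(book_arcs_cross xy x'y' t01 t'01) => pg [].
  + case/andP=> /eqP/inj xx /eqP/inj yy.
    by move: ef; rewrite exy fxy xx yy eqxx.
  + rewrite exy fxy in eE fE; case/andP=> /andP[l1 l2] l3.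
    by have := nocross _ _ _ _ eE fE l1 l2 l3; rewrite pg eqxx.
  + rewrite exy fxy in eE fE; case/andP=> /andP[l1 l2] l3.
    by have := nocross _ _ _ _ fE eE l1 l2 l3; rewrite pg eqxx.
Qed.

Local Close Scope classical_set_scope.
Local Open Scope nat_scope.

(* Vertices: z = 0, b_i = 5i+1, a_i = 5i+2 (0 <= i <= m), and, for i < m,
   u_i = 5i+3, t_i = 5i+4, v_i = 5i+5. *)
Definition ladder_rel (m x y : nat) : bool :=
  (x < y) &&
  [|| (x %% 5 == 1) && [|| y == x + 3, y == x + 4 | y == x + 5],
      (x %% 5 == 2) && [|| y == x + 1, y == x + 2 | y == x + 5],
      (x %% 5 == 3) && ((y == x + 1) || (y == x + 4)),
      (x %% 5 == 4) && [|| y == x + 1, y == x + 2 | y == x + 3],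
      [&& x %% 5 == 0, 0 < x & y == x + 1],
      (x == 0) && [|| y == 1, y == 2, y == 5 * m + 1 | y == 5 * m + 2] |
      (x == 1) && (y == 2)].

Definition ladder_edges (m : nat) : {set {set 'I_(5 * m + 2).+1}} :=
  [set e : {set 'I_(5 * m + 2).+1} |
    [exists x : 'I_(5 * m + 2).+1, exists y : 'I_(5 * m + 2).+1,
      ladder_rel m x y && (e == [set x; y])]].

Lemma card_ladder_edge (m : nat) (e : {set 'I_(5 * m + 2).+1}) :
  e \in ladder_edges m -> #|e| = 2.
Proof.
rewrite inE => /existsP[x /existsP[y /andP[/andP[xy _] /eqP->]]].
by rewrite cards2 -val_eqE /= neq_ltn xy.
Qed.

Definition ladder (m : nat) : graph := Graph (@card_ladder_edge m).

Lemma adj_ladder (m : nat) (x y : ladder m) :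
  adj (edges (ladder m)) x y = ladder_rel m x y || ladder_rel m y x.
Proof.
rewrite /adj /= inE; apply/existsP/orP.
  case=> a /existsP[b /andP[ab /eqP/set2_inj[] [-> ->]]]; by [left|right].
case=> h; [exists x; apply/existsP; exists y|exists y; apply/existsP; exists x].
  by rewrite h eqxx.
by rewrite h setUC eqxx.
Qed.

Definition ladder_page (m x y : nat) : bool :=
  [|| (x %% 5 == 2) && (y == x + 5), x %% 5 == 3, x %% 5 == 4 |
      (x == 0) && ((y == 2) || (y == 5 * m + 2))].

Lemma ladder_page_nocross (m x y z w : nat) :
  ladder_rel m x y -> ladder_rel m z w -> y < 5 * m + 3 -> w < 5 * m + 3 ->
  x < z -> z < y -> y < w -> ladder_page m x y != ladder_page m z w.
Proof.
rewrite /ladder_rel /ladder_page => /andP[xy E1] /andP[zw E2] ym wm xz zy yw.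
have [x0|x0] := posnP x.
  move: E1 E2; rewrite x0 /= orbF => E1 E2.
  lia.
have z0 : 0 < z by lia.
have xq := divn_eq x 5; have zq := divn_eq z 5.
have xr := ltn_pmod x (isT : 0 < 5); have zr := ltn_pmod z (isT : 0 < 5).
move: xq zq xr zr E1 E2; move: (x %/ 5) (z %/ 5) (x %% 5) (z %% 5) => i j r s xq zq xr zr.
move: r s xr zr xq zq => [|[|[|[|[|//]]]]] [|[|[|[|[|//]]]]] _ _ xq zq /=.
all: lia.
Qed.

Lemma ladder_planar (R : realType) (m : nat) : planar R (ladder m).
Proof.
apply: (@book_embedding_planar R (ladder m) (fun x => val (x : 'I_ _)) (ladder_page m)).
  exact: val_inj.
move=> x y z w; have lt (a : ladder m) : (a < 5 * m + 3) by have := ltn_ord a; lia.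
have E a b : [set a; b] \in edges (ladder m) = adj (edges (ladder m)) a b by [].
rewrite !E !adj_ladder /= => e1 e2 xz zy yw.
have lr a b : ladder_rel m a b -> a < b by case/andP.
apply: ladder_page_nocross => //.
  case/orP: e1 => // /lr yx; have := ltn_trans xz zy; by rewrite ltnNge (ltnW yx).
case/orP: e2 => // /lr wz; have := ltn_trans zy yw; by rewrite ltnNge (ltnW wz).
Qed.

(** * Three-connectivity of the ladder *)

Definition ladder_core (n : nat) : bool :=
  [|| n == 0, n %% 5 == 1, n %% 5 == 2 | n %% 5 == 4].

Lemma mod5 (i c : nat) : c < 5 -> (5 * i + c) %% 5 = c.
Proof. by move=> c5; rewrite mulnC modnMDl modn_small. Qed.

Lemma ladder_relE (m i c y : nat) : c < 5 -> ladder_rel m (5 * i + c) y =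
  (5 * i + c < y) &&
  [|| (c == 1) && [|| y == 5 * i + 4, y == 5 * i + 5 | y == 5 * i + 6],
      (c == 2) && [|| y == 5 * i + 3, y == 5 * i + 4 | y == 5 * i + 7],
      (c == 3) && ((y == 5 * i + 4) || (y == 5 * i + 7)),
      (c == 4) && [|| y == 5 * i + 5, y == 5 * i + 6 | y == 5 * i + 7],
      [&& c == 0, 0 < 5 * i + c & y == 5 * i + 1],
      (5 * i + c == 0) && [|| y == 1, y == 2, y == 5 * m + 1 | y == 5 * m + 2] |
      (5 * i + c == 1) && (y == 2)].
Proof.
move=> c5; rewrite /ladder_rel mod5 //.
by move: c c5 => [|[|[|[|[|//]]]]] _; rewrite -?addnA /= ?addn0.
Qed.

Lemma ladder_coreP (n : nat) : ladder_core n -> 2 < n ->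
  exists i, [\/ n = 5 * i + 6, n = 5 * i + 7 | n = 5 * i + 4].
Proof.
rewrite /ladder_core => /or4P[/eqP->|||] // /eqP nr n2.
- by exists (n %/ 5).-1; constructor 1; lia.
- by exists (n %/ 5).-1; constructor 2; lia.
- by exists (n %/ 5); constructor 3; lia.
Qed.

Lemma ladder_core5 (i c : nat) : c < 5 ->
  ladder_core (5 * i + c) = [|| 5 * i + c == 0, c == 1, c == 2 | c == 4].
Proof. by move=> c5; rewrite /ladder_core mod5. Qed.

Lemma ladder_back (m n : nat) : ladder_core n -> 2 < n ->
  exists p q, [/\ 0 < p, p < q < n, ladder_core p, ladder_core q &
                  ladder_rel m p n && ladder_rel m q n].
Proof.
move=> nc /(ladder_coreP nc)[i []] ->.
- exists (5 * i + 1), (5 * i + 4).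
  by split; rewrite ?ladder_core5 ?ladder_relE //= ?orbT //; lia.
- exists (5 * i + 2), (5 * i + 4).
  by split; rewrite ?ladder_core5 ?ladder_relE //= ?orbT //; lia.
- exists (5 * i + 1), (5 * i + 2).
  by split; rewrite ?ladder_core5 ?ladder_relE //= ?orbT //; lia.
Qed.

Lemma ladder_forward (m n : nat) : ladder_core n -> 0 < n < 5 * m + 1 ->
  exists k, [/\ n < k, k < 5 * m + 3, ladder_core k & ladder_rel m n k].
Proof.
rewrite {1}/ladder_core => /or4P[/eqP->|||] // /eqP nr; have := divn_eq n 5.
all: rewrite nr mulnC => ->; set i := n %/ 5 => nm.
- exists (5 * i + 4); split; rewrite ?ladder_core5 ?ladder_relE //= ?orbT //; lia.
- exists (5 * i + 4); split; rewrite ?ladder_core5 ?ladder_relE //= ?orbT //; lia.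
- exists (5 * i.+1 + 1); split; rewrite ?ladder_core5 ?ladder_relE //= ?orbT //; lia.
Qed.

Lemma ladder_side (m n : nat) : ~~ ladder_core n -> n < 5 * m + 3 ->
  exists p q k, [/\ p < q < k, k < 5 * m + 3,
    [&& ladder_core p, ladder_core q & ladder_core k],
    ladder_rel m p n &
    (ladder_rel m q n || ladder_rel m n q) && (ladder_rel m n k)].
Proof.
rewrite {1}/ladder_core !negb_or => nc nm.
have [[i ni]|[i ni]] : (exists i, n = 5 * i + 3) \/ (exists i, n = 5 * i.+1 + 0).
- have [nr|nr] : n %% 5 = 3 \/ n %% 5 = 0 by lia.
    by left; exists (n %/ 5); lia.
  by right; exists (n %/ 5).-1; lia.
- rewrite ni in nm *; exists (5 * i + 2), (5 * i + 4), (5 * i.+1 + 2).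
  by split; rewrite ?ladder_core5 ?ladder_relE //= ?orbT //; lia.
rewrite ni in nm *; exists (5 * i + 1), (5 * i + 4), (5 * i.+1 + 1).
by split; rewrite ?ladder_core5 ?ladder_relE //= ?orbT //; lia.
Qed.

(** The core is [z] and the subdivision vertices. By [ladder_back] each core vertex beyond 2 has two
    earlier core neighbours, so induction connects the surviving core to a base vertex; every other
    vertex has three core neighbours, one of which survives. *)
Lemma ladder_3connected (m : nat) : 0 < m -> k_connected 3 (ladder m).
Proof.
move=> m0; split; first by rewrite /= card_ord; lia.
move=> X X3.
pose r := [rel u v : ladder m |
  [&& adj (edges (ladder m)) u v, u \in ~: X & v \in ~: X]].
pose vx n : ladder m := inord n.
have vxK n : n < 5 * m + 3 -> vx n = n :> nat by move=> nm; rewrite /vx inordK //; lia.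
pose inX n := vx n \in X.
pose conn n k := connect r (vx n) (vx k).
have r_sym : symmetric r.
  by move=> u v; rewrite /r /= (adj_sym (edges (ladder m)) u v); congr (_ && _); exact: andbC.
have conn_sym n k : conn n k -> conn k n by rewrite /conn (sym_connect_sym r_sym).
have step n k : ladder_rel m n k -> k < 5 * m + 3 -> ~~ inX n -> ~~ inX k -> conn n k.
  move=> nk km nX kX; apply: connect1; rewrite /r /= !in_setC nX kX andbT adj_ladder.
  by rewrite !vxK ?nk //; case/andP: nk => nk _; exact: ltn_trans nk km.
have three p q k : p < q < k -> k < 5 * m + 3 -> inX p -> inX q -> inX k -> False.
  move=> /andP[pq qk] km pX qX kX; have : 3 <= #|X|; last by rewrite leqNgt X3.
  have pm : p < 5 * m + 3 by exact: ltn_trans pq (ltn_trans qk km).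
  have qm : q < 5 * m + 3 by exact: ltn_trans qk km.
  have <- : #|[:: vx p; vx q; vx k]| = 3.
    apply/card_uniqP; rewrite /= !inE -!val_eqE /= !vxK // negb_or.
    by rewrite !ltn_eqF // (ltn_trans pq qk).
  apply/subset_leq_card/subsetP => z; rewrite !inE.
  by case/or3P=> /eqP->.
have [c [cm cX cP]] : exists c, [/\ c < 5 * m + 3, ~~ inX c &
    forall n, ladder_core n -> n < 5 * m + 3 -> ~~ inX n -> conn n c].
  (* With [z] deleted, at most one further vertex is missing, so the descent to 1 or 2 always finds
     a surviving neighbour. *)
  have [X0|X0] := boolP (inX 0).
    pose c := if inX 1 then 2 else 1.
    have cX : ~~ inX c.
      rewrite /c; case: ifP => [X1|->//]; apply/negP => X2.
      by apply: (three 0 1 2) => //; lia.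
    exists c; split; [by rewrite /c; case: ifP; lia|by []|].
    elim/ltn_ind => n IH nc nm nX.
    have n0 : 0 < n by rewrite lt0n; apply: contraNneq nX => ->.
    have [n2|n2] := ltnP 2 n.
      have [p [q [p0 /andP[pq qn] pc qc /andP[pn' qn']]]] := ladder_back m nc n2.
      have qm := ltn_trans qn nm; have pm := ltn_trans pq qm.
      have [pX|pX] := boolP (inX p).
        have qX : ~~ inX q by apply/negP => qX; apply: (three 0 p q) => //; rewrite p0.
        exact: connect_trans (conn_sym _ _ (step _ _ qn' nm qX nX)) (IH _ qn qc qm qX).
      have pn := ltn_trans pq qn.
      exact: connect_trans (conn_sym _ _ (step _ _ pn' nm pX nX)) (IH _ pn pc pm pX).
    have [n1|n1] : n = 1 \/ n = 2 by lia.
      by rewrite n1 /c; rewrite n1 in nX; rewrite (negPf nX); exact: connect0.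
    rewrite n1 in nX *; move: cX; rewrite /c; case: ifP => X1 cX; first exact: connect0.
    by apply/conn_sym/step => //; lia.
  exists 0; split => //; first by lia.
  (* With [z] present the descent fails only if both earlier neighbours are deleted. Then nothing
     else is, and one climbs instead to [a_m] or [b_m], both adjacent to [z]. *)
  have fwd p q : p < q -> q < 5 * m + 3 -> inX p -> inX q ->
      forall d n, q < n -> 5 * m + 3 - n <= d -> ladder_core n -> n < 5 * m + 3 -> conn n 0.
    move=> pq qm pX qX; elim=> [|d IH] n qn nd nc nm; first by lia.
    have nX : ~~ inX n by apply/negP => nX; apply: (three p q n) => //; rewrite pq.
    have [nl|nl] := ltnP n (5 * m + 1).
      have [|k [nk km kc nk']] := ladder_forward nc (m := m); first by rewrite nl andbT; lia.
      have kX : ~~ inX k.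
        by apply/negP => kX; apply: (three p q k) => //; rewrite pq (ltn_trans qn nk).
      apply: connect_trans (step _ _ nk' km nX kX) (IH _ (ltn_trans qn nk) _ kc km); lia.
    by apply/conn_sym/step => //; rewrite /ladder_rel; lia.
  elim/ltn_ind => n IH nc nm nX.
  have [n2|n2] := ltnP 2 n; last first.
    have [->|n0] := posnP n; first exact: connect0.
    by apply/conn_sym/step => //; rewrite /ladder_rel; lia.
  have [p [q [p0 /andP[pq qn] pc qc /andP[pn' qn']]]] := ladder_back m nc n2.
  have qm := ltn_trans qn nm; have pm := ltn_trans pq qm; have pn := ltn_trans pq qn.
  have [pX|pX] := boolP (inX p); last first.
    exact: connect_trans (conn_sym _ _ (step _ _ pn' nm pX nX)) (IH _ pn pc pm pX).
  have [qX|qX] := boolP (inX q); last first.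
    exact: connect_trans (conn_sym _ _ (step _ _ qn' nm qX nX)) (IH _ qn qc qm qX).
  exact: (fwd p q pq qm pX qX (5 * m + 3 - n) n qn (leqnn _) nc nm).
have toc n : n < 5 * m + 3 -> ~~ inX n -> conn n c.
  move=> nm nX; have [nc|nc] := boolP (ladder_core n); first exact: cP.
  have [p [q [k [/andP[pq qk] km /and3P[pc qc kc] pn /andP[qn nk]]]]] := ladder_side nc nm.
  have qm := ltn_trans qk km; have pm := ltn_trans pq qm.
  have [pX|pX] := boolP (inX p); last first.
    exact: connect_trans (conn_sym _ _ (step _ _ pn nm pX nX)) (cP _ pc pm pX).
  have [qX|qX] := boolP (inX q); last first.
    apply: connect_trans (cP _ qc qm qX); case/orP: qn => qn; last exact: step.
    exact/conn_sym/step.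
  have kX : ~~ inX k by apply/negP => kX; apply: (three p q k) => //; rewrite pq.
  exact: connect_trans (step _ _ nk km nX kX) (cP _ kc km kX).
split; first by apply/set0Pn; exists (vx c); rewrite in_setC.
have toc' (x : ladder m) : x \in ~: X -> connect r x (vx c).
  rewrite in_setC => xX; have xm : x < 5 * m + 3 by have := ltn_ord x; lia.
  by have := toc x xm; rewrite /inX /conn /vx inord_val; apply.
move=> x y xX yX; apply: connect_trans (toc' x xX) _.
by rewrite (sym_connect_sym r_sym); exact: toc'.
Qed.

(** * Leaves on the rim *)

Definition ladder_rim (n : nat) : bool := [|| n %% 5 == 1, n %% 5 == 2 | n %% 5 == 4].

(* The two components of [ladder m] minus its rim that a rim vertex touches,
   each named by its unique vertex. *)
Definition rim_left (n : nat) : nat :=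
  match n %% 5 with
  | 1 => 5 * (n %/ 5)
  | 2 => if n %/ 5 == 0 then 0 else 5 * (n %/ 5) - 2
  | 4 => 5 * (n %/ 5) + 3
  | _ => n
  end.

Definition rim_right (m n : nat) : nat :=
  match n %% 5 with
  | 1 => if n %/ 5 == m then 0 else 5 * (n %/ 5) + 5
  | 2 => if n %/ 5 == m then 0 else 5 * (n %/ 5) + 3
  | 4 => 5 * (n %/ 5) + 5
  | _ => n
  end.

Lemma div5 (i c : nat) : c < 5 -> (5 * i + c) %/ 5 = i.
Proof. by move=> c5; rewrite mulnC divnMDl // divn_small // addn0. Qed.

Lemma rim_leftE (i c : nat) : c < 5 -> rim_left (5 * i + c) =
  match c with
  | 1 => 5 * i
  | 2 => if i == 0 then 0 else 5 * i - 2
  | 4 => 5 * i + 3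
  | _ => 5 * i + c
  end.
Proof. by move=> c5; rewrite /rim_left mod5 // div5. Qed.

Lemma rim_rightE (m i c : nat) : c < 5 -> rim_right m (5 * i + c) =
  match c with
  | 1 => if i == m then 0 else 5 * i + 5
  | 2 => if i == m then 0 else 5 * i + 3
  | 4 => 5 * i + 5
  | _ => 5 * i + c
  end.
Proof. by move=> c5; rewrite /rim_right mod5 // div5. Qed.

Lemma eq5 (n : nat) : exists i c, c < 5 /\ n = 5 * i + c.
Proof. by exists (n %/ 5), (n %% 5); rewrite ltn_pmod // mulnC -divn_eq. Qed.

Lemma rim_left_lt (m n : nat) : n < 5 * m + 3 -> rim_left n < 5 * m + 3.
Proof.
have [i [c [c5 ->]]] := eq5 n; rewrite rim_leftE //.
by case: c c5 => [|[|[|[|[|]]]]] // _ h; try case: eqP; lia.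
Qed.

Lemma rim_right_lt (m n : nat) : n < 5 * m + 3 -> rim_right m n < 5 * m + 3.
Proof.
have [i [c [c5 ->]]] := eq5 n; rewrite rim_rightE //.
by case: c c5 => [|[|[|[|[|]]]]] // _ h; try case: eqP; lia.
Qed.

Lemma rim_id (m n : nat) : ~~ ladder_rim n -> rim_left n = n /\ rim_right m n = n.
Proof.
have [i [c [c5 ->]]] := eq5 n; rewrite /ladder_rim mod5 // rim_leftE // rim_rightE //.
by case: c c5 => [|[|[|[|[|]]]]].
Qed.

(** Joined subdivision vertices come from edges with a common end, so adjacent vertices always touch
    a common component. *)
Lemma ladder_rel_share (m x y : nat) : ladder_rel m x y -> y < 5 * m + 3 ->
  [\/ rim_left x = rim_left y, rim_left x = rim_right m y,
      rim_right m x = rim_left y | rim_right m x = rim_right m y].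
Proof.
have [i [c [c5 ->]]] := eq5 x; rewrite ladder_relE // => /andP[_ E] ym.
have e5 : 5 * i + 5 = 5 * i.+1 + 0 by lia.
have e6 : 5 * i + 6 = 5 * i.+1 + 1 by lia.
have e7 : 5 * i + 7 = 5 * i.+1 + 2 by lia.
have i5 : 5 * i.+1 = 5 * i + 5 by lia.
have i52 : 5 * i.+1 - 2 = 5 * i + 3 by lia.
have inm : 5 * i + 3 <= y -> (i == m) = false by move=> ?; apply/eqP; lia.
rewrite rim_leftE // rim_rightE //.
move: c c5 E => [|[|[|[|[|//]]]]] _ /=; rewrite ?orbF.
- case/or3P=> [/andP[i0 /eqP->]|/andP[]|/andP[]]; last by lia.
    by constructor 1; rewrite rim_leftE // addn0.
  rewrite addn0 => /eqP i0; case/or4P=> /eqP->; rewrite i0.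
  + by constructor 1.
  + by constructor 1.
  + by constructor 2; rewrite rim_rightE // eqxx.
  + by constructor 2; rewrite rim_rightE // eqxx.
- have [/andP[i1 /eqP->] _|_] := boolP (_ && (y == 2)).
    by constructor 1; rewrite (_ : i = 0) //; lia.
  rewrite orbF; case/orP => [|/andP[]]; last by lia.
  case/or3P=> /eqP yE; rewrite yE inm; try lia; rewrite ?e5 ?e6.
  + by constructor 4; rewrite rim_rightE // e5.
  + by constructor 3; rewrite rim_leftE.
  + by constructor 3; rewrite rim_leftE // addn0.
- case/or3P => [|/andP[]|/andP[]]; try lia.
  case/or3P=> /eqP yE; rewrite yE inm; try lia; rewrite ?e7.
  + by constructor 3; rewrite rim_leftE.
  + by constructor 3; rewrite rim_leftE.
  + by constructor 3; rewrite rim_leftE //= i52.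
- case/or3P => [|/andP[]|/andP[]]; try lia.
  case/orP=> /eqP->; rewrite ?e7.
  + by constructor 1; rewrite rim_leftE.
  + by constructor 1; rewrite rim_leftE //= i52.
- case/or3P => [|/andP[]|/andP[]]; try lia.
  case/or3P=> /eqP->; rewrite ?e5 ?e6 ?e7.
  + by constructor 3; rewrite rim_leftE.
  + by constructor 3; rewrite rim_leftE // addn0.
  + by constructor 1; rewrite rim_leftE //= i52.
Qed.

(** Each merge of [f i] with [g i] lowers the number of classes by at most one; [c] maps an element
    to the representative of its class. *)
Lemma contract_rank (K I : finType) (f g : I -> K) (A : {set I}) :
  exists c : K -> K, {in A, forall i, c (f i) = c (g i)} /\
    forall S : {set K}, #|S| <= #|c @: S| + #|A|.
Proof.
have [n] := ubnP #|A|; elim: n A => // n IH A; rewrite ltnS => An.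
have [->|/set0Pn[i iA]] := eqVneq A set0.
  exists id; split=> [i|S]; first by rewrite in_set0.
  by rewrite cards0 addn0 imset_id.
have cA : #|A| = #|A :\ i|.+1 by rewrite (cardsD1 i) iA.
have [|c [cP cS]] := IH (A :\ i); first by rewrite -cA.
exists (fun x => if c x == c (f i) then c (g i) else c x); split=> [j jA|S].
  have [->|ji] := eqVneq j i; first by rewrite eqxx; case: eqP.
  by rewrite cP // in_setD1 ji.
rewrite cA addnS -addSn; apply: leq_trans (cS S) _; rewrite leq_add2r.
have sub : c @: S \subset c (f i) |:
    (fun x => if c x == c (f i) then c (g i) else c x) @: S.
  apply/subsetP => y /imsetP[x xS ->]; rewrite in_setU1; case: eqP => //= /eqP ne.
  by apply/imsetP; exists x => //; rewrite (negPf ne).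
by apply: leq_trans (subset_leq_card sub) _; rewrite cardsU1; case: (_ \notin _); lia.
Qed.

(** An inner vertex of a simple path has two distinct neighbours in [T]. *)
Lemma path_avoids_leaves (V : finType) (T : {set {set V}}) (D : {set V}) (x : V)
    (p : seq V) :
  D \subset leaves T -> path (adj T) x p -> uniq (x :: p) -> last x p \notin D ->
  all (fun v => v \notin D) p.
Proof.
move=> DT; elim: p x => //= y [|z p] IH x /andP[xy pp] /andP[xp up] lp; first by rewrite lp.
have /= -> := IH y pp up lp; rewrite andbT; apply/negP => /(subsetP DT); rewrite inE => /cards1P[w Tw].
have : x \in [set v | adj T y v] by rewrite inE (adj_sym T).
have : z \in [set v | adj T y v] by rewrite inE; case/andP: pp.
by rewrite Tw => /set1P zw /set1P xw; move: xp; rewrite xw -zw !inE eqxx orbT.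
Qed.

Definition rim (m : nat) : {set ladder m} := [set x : 'I_(5 * m + 2).+1 | ladder_rim x].

Lemma card_rim (m : nat) : #|rim m| = 3 * m + 2.
Proof.
have -> : #|rim m| = \sum_(i < (5 * m + 2).+1) ladder_rim i.
  rewrite -sum1_card big_mkcond /=; apply: eq_bigr => i _.
  by rewrite inE; case: ladder_rim.
elim: m => [|m IH]; first by rewrite !big_ord_recr big_ord0.
rewrite (_ : (5 * m.+1 + 2).+1 = (5 * m + 2).+2.+4); last by lia.
rewrite 5!big_ord_recr /= IH /ladder_rim.
have -> : (5 * m + 2).+1 = 5 * m + 3 by lia.
have -> : (5 * m + 3).+1 = 5 * m + 4 by lia.
have -> : (5 * m + 4).+1 = 5 * m.+1 + 0 by lia.
have -> : (5 * m.+1 + 0).+1 = 5 * m.+1 + 1 by lia.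
have -> : (5 * m.+1 + 1).+1 = 5 * m.+1 + 2 by lia.
rewrite !mod5 //=; lia.
Qed.

(** Merge the two components touched by each rim vertex that is not a leaf. Tree paths between
    vertices off the rim avoid rim leaves, so all 2m + 1 components fall into one class. This takes
    at least 2m merges. *)
Lemma rim_leaves (m : nat) (T : {set {set ladder m}}) :
  spanning_tree T -> #|rim m :&: leaves T| <= m + 2.
Proof.
case=> TE /connected_onTE conT _.
have lt (x : ladder m) : x < 5 * m + 3 by have := ltn_ord x; lia.
pose L (x : ladder m) : ladder m := inord (rim_left x).
pose Q (x : ladder m) : ladder m := inord (rim_right m x).
have LE x : L x = rim_left x :> nat.
  by rewrite /L inordK //; have := rim_left_lt (lt x); lia.
have QE x : Q x = rim_right m x :> nat.
  by rewrite /Q inordK //; have := rim_right_lt (lt x); lia.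
have [c [cA cS]] := contract_rank L Q (rim m :\: leaves T).
have LQ x : x \notin rim m -> L x = x /\ Q x = x.
  by rewrite inE => /(rim_id m)[h1 h2]; split; apply: val_inj; rewrite /= ?LE ?QE.
have cLQ x : x \notin rim m :&: leaves T -> c (L x) = c (Q x).
  have [xR|/LQ[-> ->] //] := boolP (x \in rim m).
  by rewrite in_setI xR /= => xT; apply: cA; rewrite in_setD xT.
have rel_eq (x y : ladder m) : ladder_rel m x y -> x \notin rim m :&: leaves T ->
    y \notin rim m :&: leaves T -> c (L x) = c (L y).
  move=> /ladder_rel_share/(_ (lt y)) share /cLQ cx /cLQ cy.
  have eqv (u v : ladder m) : u = v :> nat -> u = v by apply: val_inj.
  case: share => E; first by rewrite (eqv (L x) (L y)) ?LE.
  - by rewrite cy (eqv (L x) (Q y)) ?LE ?QE.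
  - by rewrite cx (eqv (Q x) (L y)) ?LE ?QE.
  - by rewrite cx cy (eqv (Q x) (Q y)) ?QE.
have adj_eq (x y : ladder m) : adj T x y -> x \notin rim m :&: leaves T ->
    y \notin rim m :&: leaves T -> c (L x) = c (L y).
  move=> /(subsetP TE) xy xD yD; have : adj (edges (ladder m)) x y by [].
  rewrite adj_ladder => /orP[h|h]; first exact: rel_eq.
  by apply/esym/rel_eq.
have const (x y : ladder m) : x \notin rim m -> y \notin rim m -> c x = c y.
  move=> xR yR; have [Lx _] := LQ _ xR; have [Ly _] := LQ _ yR.
  rewrite -Lx -Ly; have /connectP[p0 p0T p0y] := conT x y.
  case: (shortenP p0T) p0y => p pT up _ {p0 p0T} py.
  have xD : x \notin rim m :&: leaves T by rewrite in_setI (negPf xR).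
  have yD : y \notin rim m :&: leaves T by rewrite in_setI (negPf yR).
  rewrite py in yD *.
  have := path_avoids_leaves (subsetIr _ _) pT up yD.
  elim: p x pT xD {xR Lx conT up py yD} => //= z p IH x /andP[xz pp] xD /andP[zD pD].
  by rewrite (adj_eq x z) // IH.
have := cS (~: rim m); have := cardsC (rim m); rewrite card_rim cardsD.
have := subset_leq_card (subsetIl (rim m) (leaves T)); rewrite card_rim.
have : #|c @: (~: rim m)| <= 1.
  rewrite -(cards1 (c (ord0 : 'I_(5 * m + 2).+1))); apply/subset_leq_card/subsetP => y.
  case/imsetP=> x; rewrite in_setC => xR ->; rewrite in_set1; apply/eqP/const => //.
  by rewrite inE /ladder_rim mod0n.
rewrite /= card_ord; lia.
Qed.

Local Open Scope ring_scope.

Lemma robust_connectivity_ladder (R : realType) (m : nat) :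
  robust_connectivity R (ladder m) <= (m + 2)%:R / (3 * m + 2)%:R.
Proof.
have c0 : (0 < 3 * m + 2)%N by rewrite addn2.
apply: (bigmin_inf (rim m)); first by rewrite -card_gt0 card_rim.
apply/bigmax_leP; split=> [|T /asboolP sT]; first by rewrite divr_ge0 ?ler0n.
rewrite card_rim ler_pM2r ?invr_gt0 ?ltr0n // ler_nat; exact: rim_leaves.
Qed.

Theorem theorem3 (R : realType) :
  (forall G : graph, k_connected 3 G -> planar R G ->
     21 / 256 <= robust_connectivity R G) /\
  (forall eps : R, 0 < eps ->
     exists H : graph, [/\ k_connected 3 H, planar R H &
       robust_connectivity R H <= 1 / 3 + eps]).
Proof.
split=> [G con [pos [gamma emb]]|eps eps0].
  exact: robust_connectivity_lower con (plane_embedding_van_kampen emb).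
(* The successor makes [m] positive and larger than 1/eps, while (m + 2)/(3m + 2) exceeds 1/3 by
   only 4/(9m + 6). *)
pose m := (Num.truncn eps^-1).+1; exists (ladder m); split.
- exact: ladder_3connected.
- exact: ladder_planar.
apply: le_trans (robust_connectivity_ladder R m) _.
have em : 1 <= eps * m%:R.
  rewrite mulrC -ler_pdivrMr // mul1r; apply: ltW.
  exact: truncnS_gt.
rewrite ler_pdivrMr; last by rewrite ltr0n addn2.
rewrite !natrD natrM.
have m0 : 0 <= m%:R :> R by exact: ler0n.
nra.
Qed.
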